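(* Let $\gamma^*>0$ satisfy $$E\left[\max\left(W^*(\gamma^*;f(n))-\tfrac T2\gamma^*,\,0\right)\right]=\frac{\tau\gamma^*}{2p_s}.$$ Then the pair $\{N^*,M^*\}$ given by $$M^*=M^*(\gamma^* )=\min\left\{m\ge1:\tfrac T2R^f_m\ge W^*(\gamma^*;f)+\tfrac T2\gamma^*\right\},\qquad N^*=\min\left\{n\ge1:W^*(\gamma^*;f(n))\ge\tfrac T2\gamma^*\right\}$$ is optimal for the two-layer stopping problem and achieves the maximal average system throughput $\gamma^*$; that is, $$\gamma^*=\frac{E\{\overline Y_{M^*}(f(N^* ))\}}{E\{\overline T_{M^*}(f(N^* ))+T_{N^*}\}}=\sup_{(N,M)}\frac{E\{\overline Y_M(f(N))\}}{E\{\overline T_M(f(N))+T_N\}},$$ the supremum being over all pairs of a main-layer stopping rule $N$ and a sub-layer stopping rule $M$ for which the denominator is finite.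
   Context: Let $K,L\ge1$ be integers, $T,\tau,P_s,P_r,\sigma_f^2,\sigma_g^2>0$ constants, $p_0,p_1\in(0,1)$, $p_s=Kp_0(1-p_0)^{K-1}$, $p_r=Lp_1(1-p_1)^{L-1}$. Sub-layer problem (for fixed $f=(f_1,\dots,f_L)\in\mathbb{C}^L$). For $m=1,2,\dots$: $s(m)$ is uniform on $\{1,\dots,L\}$; $K'_m$ is geometric with $\mathrm{Prob}(K'_m=k)=p_r(1-p_r)^{k-1}$, $k\ge1$; $g_1(m),\dots,g_L(m)$ are (circularly symmetric) complex Gaussian with mean zero and variance $\sigma_g^2$; all mutually independent. Put $$R_m^f=\log_2\left(1+\frac{P_sP_r|f_{s(m)}|^2|g_{s(m)}(m)|^2}{1+P_s|f_{s(m)}|^2+P_r|g_{s(m)}(m)|^2}\right),\quad Y^f_m=\tfrac T2R^f_m,\quad T'_m=\tfrac T2+\tfrac\tau2\sum_{i=1}^mK'_i.$$ A sub-layer stopping rule $M$ assigns (measurably) to each $f$ a stopping time with values in $\{1,2,\dots\}$, with respect to the filtration generated by $(s(m),K'_m,g_{s(m)}(m))$, with $E(T'_M)<\infty$ for each $f$; write $\overline Y_M(f)=E(Y^f_M)$ and $\overline T_M(f)=E(T'_M)$ for the expectations given $f$. For $\gamma>0$, $W^*(\gamma;f)=\sup_M E(Y^f_M-\gamma T'_M)$; it is the unique root $w$ of $E[\max(\frac T2R^f_m-\frac T2\gamma,w)]=w+\frac{\gamma\tau}{2p_r}$. Main layer. For $n=1,2,\dots$: $s(n)$ is uniform on $\{1,\dots,K\}$;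 $K_n$ is geometric with $\mathrm{Prob}(K_n=k)=p_s(1-p_s)^{k-1}$, $k\ge1$; the gains $f_{ij}(n)$ ($1\le i\le K,1\le j\le L$) are (circularly symmetric) complex Gaussian with mean zero and variance $\sigma_f^2$; all mutually independent within and across observations. Write $f(n)=(f_{s(n)1}(n),\dots,f_{s(n)L}(n))$ and $T_n=\frac T2+\frac\tau2\sum_{i=1}^nK_i$. A main-layer stopping rule is a stopping time $N$ with values in $\{1,2,\dots\}$ with respect to the filtration generated by $(s(n),K_n,f(n))$, $n\ge1$. *)

(* Defs.v *)
From HB Require Import structures.
From mathcomp Require Import all_boot all_order all_algebra.
From mathcomp Require Import complex.
From mathcomp Require Import all_classical all_reals all_analysis.

Set Implicit Arguments.
Unset Strict Implicit.
Unset Printing Implicit Defensive.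

Import Order.TTheory GRing.Theory Num.Theory.
Import numFieldNormedType.Exports.

Local Open Scope classical_set_scope.
Local Open Scope ring_scope.
Local Open Scope complex_scope.

(* The Borel sigma-algebra of the complex plane, generated by Re and Im, just
   as the product sigma-algebra is generated by fst and snd. Through the
   library's tuple instance it makes L.-tuple R[i], i.e. C^L, measurable. *)
Section complex_measurable.
Context (R : realType).

HB.instance Definition _ := isPointed.Build R[i] 0.

Definition complex_measurable : set_system R[i] :=
  g_sigma_preimageU (@complex.Re R) (@complex.Im R).

Let complex_measurable0 : complex_measurable set0.
Proof. exact: (@sigma_algebra0 _ setT). Qed.

Let complex_measurableC A :
  complex_measurable A -> complex_measurable (~` A).
Proof. exact: sigma_algebraC. Qed.

Let complex_measurable_bigcup (F : (set R[i])^nat) :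
  (forall i, complex_measurable (F i)) ->
  complex_measurable (\bigcup_i (F i)).
Proof. exact: (@sigma_algebra_bigcup _ setT). Qed.

HB.instance Definition _ := @isMeasurable.Build default_measure_display
  R[i] complex_measurable complex_measurable0 complex_measurableC
  complex_measurable_bigcup.

End complex_measurable.

Section probability.
Context d (Omega : measurableType d) (R : realType) (P : probability Omega R).

Definition mutually_independent (I : eqType) (F : I -> set_system Omega) :=
  forall J : seq I, uniq J ->
  forall A : I -> set Omega, (forall i, i \in J -> F i (A i)) ->
  P (\bigcap_(i in [set` J]) A i) = (\prod_(i <- J) P (A i))%E.

Definition uniform_law (k : nat) (s : Omega -> 'I_k) :=
  forall i, measurable (s @^-1` [set i]) /\
            P (s @^-1` [set i]) = (k%:R^-1)%:E.

Definition geometric_law (X : {RV P >-> nat}) (p : R) :=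
  forall k, (0 < k)%N ->
  P (X @^-1` [set k]) = (p * (1 - p) ^+ k.-1)%:E.

(* Circularly symmetric, mean 0 and variance E|Z|^2 = v: the real and the
   imaginary part are independent N(0, v/2) variables. The second argument of
   normal_prob is the standard deviation. *)
Definition circular_gaussian_law (Z : {RV P >-> R[i]}) (v : R) :=
  let nu := normal_prob (0 : R) (Num.sqrt (v / 2)) in
  forall A B : set R, measurable A -> measurable B ->
  P [set w | A (complex.Re (Z w)) /\ B (complex.Im (Z w))] = (nu A * nu B)%E.

(* Times are indexed from 1: the variables of index 0 are not constrained and
   never used. *)
Section layer.
Context (k : nat) (J : eqType).
Context (s : nat -> Omega -> 'I_k) (X : nat -> {RV P >-> nat}).
Context (h : nat -> J -> {RV P >-> R[i]}).

Definition layer_sigma (i : nat + nat + nat * J) : set_system Omega :=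
  match i with
  | inl (inl n) => preimage_set_system setT (s n.+1) setT
  | inl (inr n) => preimage_set_system setT (X n.+1) measurable
  | inr (n, j) => preimage_set_system setT (h n.+1 j) measurable
  end.

(* s(n): uniformly chosen index, X(n): number of contention slots, h(n): gains. *)
Record layer_model (p v : R) : Prop := LayerModel {
  layer_uniform : forall n, (0 < n)%N -> uniform_law (s n);
  layer_geometric : forall n, (0 < n)%N -> geometric_law (X n) p;
  layer_gaussian : forall n j, (0 < n)%N -> circular_gaussian_law (h n j) v;
  layer_independent : mutually_independent layer_sigma }.

Definition slot_time (T tau : R) (n : nat) (w : Omega) : R :=
  T / 2 + tau / 2 * \sum_(1 <= i < n.+1) (X i w)%:R.

(* sigma-algebra generated by s(i), X(i), O(i) for 1 <= i <= n, where O(i) is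
   the observed part of the gains h(i). *)
Definition filtration d' (V : measurableType d') (O : nat -> Omega -> V)
    (n : nat) : set_system Omega :=
  <<s \bigcup_(i in [set i | (0 < i <= n)%N])
        (preimage_set_system setT (s i) setT `|`
         preimage_set_system setT (X i) measurable `|`
         preimage_set_system setT (O i) measurable) >>.

End layer.

(* Stopping times with values in {1, 2, ...}, finite almost surely; None stands
   for never stopping. *)
Definition stopping_time (F : nat -> set_system Omega)
    (N : Omega -> option nat) :=
  [/\ forall w, N w != Some 0%N,
      forall n, F n [set w | N w = Some n] &
      P [set w | N w = None] = 0%E].

Definition stopped (V : nmodType) (Z : nat -> Omega -> V)
    (N : Omega -> option nat) (w : Omega) : V :=
  if N w is Some n then Z n w else 0.

Definition first_time (Q : nat -> pred Omega) (w : Omega) : option nat :=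
  match pselect (exists n, (0 < n)%N && Q n w) with
  | left h => Some (ex_minn h)
  | right _ => None
  end.

End probability.

Definition success_prob (R : realType) (k : nat) (p : R) : R :=
  k%:R * p * (1 - p) ^+ k.-1.

Section sub_layer.
Context d (Omega : measurableType d) (R : realType) (P : probability Omega R).
Context (L : nat) (T tau Ps Pr : R).
Context (s : nat -> Omega -> 'I_L) (X : nat -> {RV P >-> nat}).
Context (g : nat -> 'I_L -> {RV P >-> R[i]}).

Definition sub_rate (f : L.-tuple R[i]) (m : nat) (w : Omega) : R :=
  let a := ComplexField.Normc.normc (tnth f (s m w)) ^+ 2 in
  let b := ComplexField.Normc.normc (g m (s m w) w) ^+ 2 in
  ln (1 + Ps * Pr * a * b / (1 + Ps * a + Pr * b)) / ln 2.

Definition sub_reward (f : L.-tuple R[i]) (m : nat) (w : Omega) : R :=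
  T / 2 * sub_rate f m w.

Definition sub_filtration : nat -> set_system Omega :=
  filtration s X (fun m w => g m (s m w) w).

Definition mean_reward (M : L.-tuple R[i] -> Omega -> option nat)
    (f : L.-tuple R[i]) : \bar R :=
  ('E_P[stopped (sub_reward f) (M f)])%E.

Definition mean_time (M : L.-tuple R[i] -> Omega -> option nat)
    (f : L.-tuple R[i]) : \bar R :=
  ('E_P[stopped (slot_time X T tau) (M f)])%E.

Record sub_rule (M : L.-tuple R[i] -> Omega -> option nat) : Prop := SubRule {
  sub_rule_stopping : forall f, stopping_time P sub_filtration (M f);
  sub_rule_measurable : forall m,
    measurable [set x : L.-tuple R[i] * Omega | M x.1 x.2 = Some m];
  sub_rule_finite : forall f, (mean_time M f < +oo)%E }.

(* W^*(gamma; f) *)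
Definition sub_value (gamma : R) (f : L.-tuple R[i]) : \bar R :=
  ereal_sup
    [set ('E_P[fun w => (stopped (sub_reward f) (M f) w
                 - gamma * stopped (slot_time X T tau) (M f) w)%R])%E
    | M in sub_rule].

(* M^*(gamma) *)
Definition sub_threshold_rule (gamma : R) (f : L.-tuple R[i]) :
    Omega -> option nat :=
  first_time (fun m w =>
    (sub_value gamma f + (T / 2 * gamma)%:E <= (sub_reward f m w)%:E)%E).

End sub_layer.

Section main_layer.
Context d (Omega : measurableType d) (R : realType) (P : probability Omega R).
Context (K L : nat) (T tau : R).
Context (s : nat -> Omega -> 'I_K) (X : nat -> {RV P >-> nat}).
Context (f : nat -> 'I_K * 'I_L -> {RV P >-> R[i]}).

(* f(n), the gains from the selected source s(n) *)
Definition source_gains (n : nat) (w : Omega) : L.-tuple R[i] :=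
  [tuple f n (s n w, j) w | j < L].

Definition main_rule (N : Omega -> option nat) :=
  stopping_time P (filtration s X source_gains) N.

(* E{Ybar(f(N))} and E{Tbar(f(N)) + T_N}, for the sub-layer expectations Ybar
   and Tbar as functions of the gains *)
Definition total_reward (Ybar : L.-tuple R[i] -> \bar R)
    (N : Omega -> option nat) : \bar R :=
  (\int[P]_w stopped (fun n w => Ybar (source_gains n w)) N w)%E.

Definition total_time (Tbar : L.-tuple R[i] -> \bar R)
    (N : Omega -> option nat) : \bar R :=
  (\int[P]_w stopped (fun n w =>
     Tbar (source_gains n w) + (slot_time X T tau n w)%:E) N w)%E.

End main_layer.

(* Main.v *)
Require Import Defs.
From HB Require Import structures.
From mathcomp Require Import all_boot all_order all_algebra.
From mathcomp Require Import complex.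
From mathcomp Require Import all_classical all_reals all_analysis.
From mathcomp Require Import measurable_realfun lebesgue_measure.
From mathcomp Require Import ring lra.

Set Implicit Arguments.
Unset Strict Implicit.
Unset Printing Implicit Defensive.

Import Order.TTheory GRing.Theory Num.Theory.
Local Open Scope classical_set_scope.
Local Open Scope ring_scope.
Local Open Scope complex_scope.

(* Both layers are governed by the same argument. Let Z_1, Z_2, ... be rewards
   such that Z_n is independent of the past, and let theta solve
   E(Z - theta)^+ = delta, where delta is the price of one more observation.
   For every stopping time N,
     Z_N <= theta + sum_(i <= N) (Z_i - theta)^+,
   with equality for the first n such that Z_n >= theta, and by Wald's identity
   the sum has expectation delta E N.
   In the sub-layer Z_m is the reward, delta = gamma tau / (2 p_r) and E N enters
   the expected time linearly, so W^*(gamma; f) = theta(f) - gamma T / 2, and the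
   threshold rule attains it. In the main layer Z_n = W^*(gamma; f(n)), the
   equation for gamma^* says that the root is theta = gamma T / 2, and the same
   bound becomes: reward <= gamma time, with equality for the pair of threshold
   rules. The expected time of that pair is finite because the reward given f is
   O(sum_j |f_j|^2), which has finite expectation. *)

(** * Independence and transfer of laws *)

(** A rule observes only the gain of the selected index, and which gain that is depends on [s]. The
    hypothesis [layer_independent] speaks of single generators, so independence is extended to
    generated sigma-algebras, and a random selection is removed by splitting along the value of [s].
    Upper bounds are proved for stopping times of the larger [layer_past], whereas the threshold
    rules are checked against the observed filtration itself. The stopped sums are integrals of
    nonnegative functions with values in [\bar R], where Wald's identity is a termwise summation and
    infinite means do no harm. The root theta(f) is constructed as a supremum, because its
    measurability in f is what makes the threshold rule jointly measurable. The expected time of the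
    optimal pair is controlled through its reward: where the main rule stops, W^*(gamma; f) is
    positive, so gamma times the sub-layer time is at most the sub-layer reward. Stopping biases the
    law of f at the random time, so this bound is summed over all observations made before Wald's
    identity is applied. *)

Section independence.
Local Open Scope ereal_scope.
Context d (Omega : measurableType d) (R : realType) (P : probability Omega R).

Lemma bigcap_seq_measurable (I : choiceType) (J : seq I) (A : I -> set Omega) :
  (forall j, j \in J -> measurable (A j)) ->
  measurable (\bigcap_(j in [set` J]) A j).
Proof.
move=> mA; rewrite bigcap_seq big_seq; apply: bigsetI_measurable => j jJ.
exact: mA.
Qed.

(** Uniqueness of measures: [mrestr P mC] and [mscale k P], with k = P C, are finite measures that
    agree on the pi-system of finite intersections of events from [F i], i in [D]. *)
Lemma mutually_independent_sigma (I : choiceType) (F : I -> set_system Omega)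
    (D : set I) (J : seq I) (A : I -> set Omega) (B : set Omega) :
  (forall i, F i `<=` measurable) -> (forall i, setI_closed (F i)) ->
  (forall i, F i setT) -> mutually_independent P F ->
  uniq J -> (forall j, j \in J -> ~ D j /\ F j (A j)) ->
  <<s \bigcup_(i in D) F i >> B ->
  P (B `&` \bigcap_(j in [set` J]) A j) = P B * \prod_(j <- J) P (A j).
Proof.
move=> mF FI FT indF uJ JA FB.
pose C := \bigcap_(j in [set` J]) A j.
have mC : measurable C.
  by apply: bigcap_seq_measurable => j /JA[_ /mF].
have PC : P C = \prod_(j <- J) P (A j) by apply: indF => // i /JA[].
pose G : set_system Omega := [set B | exists J' : seq I, exists A' : I -> set Omega,
  [/\ uniq J', (forall j, j \in J' -> D j /\ F j (A' j)) &
      B = \bigcap_(j in [set` J']) A' j]].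
have GD : \bigcup_(i in D) F i `<=` G.
  move=> E [i Di FE]; exists [:: i], (fun=> E); split => //.
    by move=> j; rewrite inE => /eqP ->.
  by rewrite bigcap_seq big_seq1.
pose k : {nonneg R} := NngNum (fine_ge0 (measure_ge0 P C)).
have PCk : P C = k%:num%:E by rewrite /= fineK// fin_num_measure.
have kE E : mscale k P E = P C * P E by rewrite /mscale PCk.
suff : mrestr P mC B = mscale k P B by rewrite kE PC muleC.
apply: (g_sigma_algebra_measure_unique G _ (fun=> setT)) => //.
- move=> E [J' [A' [_ H ->]]].
  by apply: bigcap_seq_measurable => j /H[_ /mF].
- move=> _; exists [::], (fun=> setT); split => //.
  by rewrite bigcap_seq big_nil.
- by rewrite bigcup_const//; exists 0%N.
- move=> _ _ [J1 [A1 [u1 H1 ->]]] [J2 [A2 [u2 H2 ->]]].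
  (* An index may occur in both lists; its two events are then intersected, which [setI_closed]
     allows. A missing event is replaced by the full space. *)
  exists (undup (J1 ++ J2)), (fun i => (if i \in J1 then A1 i else setT) `&`
    (if i \in J2 then A2 i else setT)); split; first exact: undup_uniq.
    move=> j; rewrite mem_undup mem_cat => jJ; split.
      by case/orP : jJ => [/H1|/H2] [].
    by apply: FI; case: ifPn => [iJ|_] //; [have [] := H1 _ iJ|have [] := H2 _ iJ].
  apply/seteqP; split => [w [w1 w2] j|w H] /=.
    rewrite mem_undup mem_cat => jJ; split; case: ifPn => // jJ'.
      exact: w1.
    exact: w2.
  split => j /= jJ.
    by have /= := H j; rewrite mem_undup mem_cat jJ => /(_ isT)[].
  by have /= := H j; rewrite mem_undup mem_cat jJ orbT => /(_ isT)[].
- move=> E [J' [A' [u' H' ->]]].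
  rewrite [RHS]kE PC /= /mrestr.
  (* [J'] lies in [D] and [J] avoids it, so the two families glue into one and independence applies
     to [J' ++ J]. *)
  pose A'' i := if i \in J' then A' i else A i.
  have eA' j : j \in J' -> A'' j = A' j by rewrite /A'' => ->.
  have eA j : j \in J -> A'' j = A j.
    move=> jJ; rewrite /A''; case: ifPn => // /H'[Dj _].
    by have [] := JA _ jJ.
  have := indF (J' ++ J) _ A'' _.
  rewrite bigcap_seq !big_cat/= -!bigcap_seq.
  rewrite (eq_bigcapr eA') (eq_bigcapr eA).
  rewrite (eq_big_seq (fun i => P (A' i))); last by move=> i /eA' /= ->.
  rewrite [X in _ = _ * X](eq_big_seq (fun i => P (A i))); last by move=> i /eA /= ->.
  move=> ->.
  + by rewrite muleC; congr (_ * _); apply/esym/indF => // i /H'[].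
  + rewrite cat_uniq u' uJ andbT/=; apply/hasPn => j /JA[nDj _] /=.
    by apply/negP => /H'[].
  + move=> i; rewrite mem_cat => /orP[iJ|iJ].
      by rewrite eA'//; have [] := H' _ iJ.
    by rewrite eA//; have [] := JA _ iJ.
- by move=> _; rewrite -ge0_fin_numE// fin_num_measure.
- by move: FB; apply: sub_smallest2r; [exact: smallest_sigma_algebra|].
Qed.
End independence.

Section transfer.
Local Open Scope ereal_scope.
Context d (Omega : measurableType d) (R : realType).
Context (mu : {measure set Omega -> \bar R}).

Lemma ge0_integral_mrestr (B : set Omega) (mB : measurable B)
    (f : Omega -> \bar R) :
  measurable_fun setT f -> (forall w, 0 <= f w) ->
  \int[mrestr mu mB]_w f w = \int[mu]_(w in B) f w.
Proof.
move=> mf f0; have mBC := measurableC mB.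
rewrite -(setUv B) ge0_integral_setU//; first last.
- by apply/disj_set2P; rewrite setICr.
- by rewrite setUv.
rewrite [X in _ + X]null_set_integral ?adde0//; first last.
- by rewrite /= /mrestr setICl measure0.
- exact: measurable_funTS.
by apply: eq_measure_integral => A mA AB; rewrite /= /mrestr setIidl.
Qed.

(** The hypothesis says that under [mu] restricted to [B] the law of [H] is [c] times the law of
    [H']; both sides integrate [phi] against these image measures. With [c] the probability of [B],
    it expresses independence and equality of laws at once. *)
Lemma eq_law_integral d' (V : measurableType d') (B : set Omega)
    (H H' : Omega -> V) (c : \bar R) (phi : V -> \bar R) :
  measurable B -> measurable_fun setT H -> measurable_fun setT H' ->
  0 <= c -> c \is a fin_num ->
  (forall D, measurable D ->
     mu (B `&` H @^-1` D) = c * mu (H' @^-1` D)) ->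
  measurable_fun setT phi -> (forall v, 0 <= phi v) ->
  \int[mu]_(w in B) phi (H w) = c * \int[mu]_w phi (H' w).
Proof.
move=> mB mH mH' c0 cf HH' mphi phi0.
pose k : {nonneg R} := NngNum (fine_ge0 c0).
have ck : c = k%:num%:E by rewrite /= fineK.
rewrite -(ge0_integral_mrestr mB); [|exact: measurableT_comp|by []].
rewrite ck -ge0_integral_mscale//; last exact: measurableT_comp.
rewrite -[LHS](@ge0_integral_pushforward _ _ _ _ _ _ mH (mrestr mu mB) setT)//.
rewrite -[RHS](@ge0_integral_pushforward _ _ _ _ _ _ mH' (mscale k mu) setT)//.
apply: eq_measure_integral => A mA _.
rewrite -[LHS]/(mu (H @^-1` A `&` B)) setIC HH'// ck.
by [].
Qed.
End transfer.

(** * Borel sets of the complex plane and the circular Gaussian law *)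

Section complex_plane.
Context (R : realType).

Lemma measurable_Re : measurable_fun setT (@complex.Re R : R[i] -> R).
Proof.
by move=> _ A mA; apply: sub_sigma_algebra; left; exists A.
Qed.

Lemma measurable_Im : measurable_fun setT (@complex.Im R : R[i] -> R).
Proof.
by move=> _ A mA; apply: sub_sigma_algebra; right; exists A.
Qed.

Lemma measurable_normc_sqr :
  measurable_fun setT (fun z : R[i] => ComplexField.Normc.normc z ^+ 2).
Proof.
rewrite (_ : (fun z => _) = fun z : R[i] => complex.Re z ^+ 2 + complex.Im z ^+ 2).
  by apply: measurable_funD; apply: measurable_funX;
    [exact: measurable_Re|exact: measurable_Im].
by apply/funext => -[x y]; rewrite /= sqr_sqrtr// addr_ge0// sqr_ge0.
Qed.

Context d (Omega : measurableType d) (P : probability Omega R).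

(** The law is prescribed on rectangles only. They form a pi-system, and those with one side equal
    to the full line already generate the sigma-algebra. *)
Lemma circular_gaussian_law_unique (Z Z' : {RV P >-> R[i]}) (v : R) D :
  circular_gaussian_law Z v -> circular_gaussian_law Z' v -> measurable D ->
  P (Z @^-1` D) = P (Z' @^-1` D).
Proof.
move=> lZ lZ' mD.
pose G : set_system R[i] := [set D | exists A B : set R,
  [/\ measurable A, measurable B &
      D = [set z | A (complex.Re z) /\ B (complex.Im z)]]].
have GE A B : measurable A -> measurable B ->
    G [set z | A (complex.Re z) /\ B (complex.Im z)].
  by move=> mA mB; exists A, B.
apply: (@g_sigma_algebra_measure_unique _ _ _ G _ (fun=> setT) _ _
  (pushforward P Z) (pushforward P Z')) => //.
- move=> _ [A [B [mA mB ->]]]; apply: measurableI.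
    by rewrite -[X in measurable X]setTI; exact: measurable_Re.
  by rewrite -[X in measurable X]setTI; exact: measurable_Im.
- by move=> _; exists setT, setT; split => //; apply/seteqP; split.
- by rewrite bigcup_const//; exists 0%N.
- move=> _ _ [A [B [mA mB ->]]] [A' [B' [mA' mB' ->]]].
  exists (A `&` A'), (B `&` B'); split; try exact: measurableI.
  by apply/seteqP; split => z /=; tauto.
- by move=> _ [A [B [mA mB ->]]]; rewrite /= /pushforward lZ// lZ'.
- by move=> _; rewrite /= /pushforward preimage_setT probability_setT ltry.
- move: mD; apply: smallest_sub; first exact: smallest_sigma_algebra.
  move=> _ [|] [A mA <-]; rewrite setTI; apply: sub_sigma_algebra.
    by exists A, setT; split => //; apply/seteqP; split => // z [].
  by exists setT, A; split => //; apply/seteqP; split => // z [].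
Qed.
End complex_plane.

(** * Observations of a layer *)

Section layer.
Local Open Scope ereal_scope.
Context d (Omega : measurableType d) (R : realType) (P : probability Omega R).
Context (k : nat) (J : choiceType) (s : nat -> Omega -> 'I_k).
Context (X : nat -> {RV P >-> nat}) (h : nat -> J -> {RV P >-> R[i]}).
Context (p v : R) (hm : layer_model s X h p v).

Lemma measurable_index n : (0 < n)%N -> forall B, measurable (s n @^-1` B).
Proof.
move=> n0 B; rewrite (_ : _ @^-1` B = \bigcup_(i in B) s n @^-1` [set i]).
  apply: fin_bigcup_measurable; first exact: finite_finset.
  by move=> i _; have [] := layer_uniform hm n0 i.
by apply/seteqP; split => [w Bw|w [i Bi /= ->]]//; exists (s n w).
Qed.

Lemma layer_sigma_measurable i : layer_sigma s X h i `<=` measurable.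
Proof.
case: i => [[n|n]|[n j]] A [B mB <-]; rewrite setTI.
- exact: measurable_index.
- by rewrite -[X in measurable X]setTI; exact: measurable_funP.
- by rewrite -[X in measurable X]setTI; exact: measurable_funP.
Qed.

Lemma layer_sigmaI i : setI_closed (layer_sigma s X h i).
Proof.
case: i => [[n|n]|[n j]] _ _ [A mA <-] [B mB <-]; rewrite !setTI -preimage_setI;
  exists (A `&` B); rewrite ?setTI//; exact: measurableI.
Qed.

Lemma layer_sigmaT i : layer_sigma s X h i setT.
Proof. by case: i => [[n|n]|[n j]]; exists setT; rewrite ?setTI. Qed.

(* The index n of layer_sigma stands for time n.+1. *)
Definition layer_time (i : nat + nat + nat * J) : nat :=
  match i with inl (inl n) | inl (inr n) | inr (n, _) => n end.

(* Unlike [filtration], this contains all the gains, observed or not, so that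
   independence of the past can be proved once for both layers. *)
Definition layer_past (n : nat) : set_system Omega :=
  <<s \bigcup_(i in [set i | (layer_time i < n)%N]) layer_sigma s X h i >>.

Lemma layer_past_measurable n : layer_past n `<=` measurable.
Proof.
apply: smallest_sub; first exact: sigma_algebra_measurable.
by move=> A [i _]; exact: layer_sigma_measurable.
Qed.

Lemma filtration_layer_past d' (V : measurableType d') (O : nat -> Omega -> V) :
  (forall n D, measurable D -> layer_past n.+1 (O n.+1 @^-1` D)) ->
  forall n, filtration s X O n `<=` layer_past n.
Proof.
move=> mO n; apply: smallest_sub; first exact: smallest_sigma_algebra.
move=> A [[//|m] /= mn].
have past_le : layer_past m.+1 `<=` layer_past n.
  apply: smallest_sub; first exact: smallest_sigma_algebra.
  move=> B [i /= im FB]; apply: sub_gen_smallest; exists i => //=.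
  exact: leq_trans im mn.
move=> [[[B mB <-]|[B mB <-]]|[B mB <-]]; apply: past_le; rewrite setTI.
- apply: sub_gen_smallest; exists (inl (inl m)) => //=.
  by exists B => //; rewrite setTI.
- apply: sub_gen_smallest; exists (inl (inr m)) => //=.
  by exists B => //; rewrite setTI.
- exact: mO.
Qed.

Lemma layer_past_index n i B : layer_past n B ->
  P (B `&` s n.+1 @^-1` [set i]) = P B * (k%:R^-1)%:E.
Proof.
move=> nB.
have := @mutually_independent_sigma _ _ _ P _ (layer_sigma s X h)
  _ [:: inl (inl n)] (fun=> s n.+1 @^-1` [set i]) B layer_sigma_measurable
  layer_sigmaI layer_sigmaT (layer_independent hm) _ _ nB.
rewrite bigcap_seq !big_seq1 => ->//.
  by have [_ ->] := layer_uniform hm (ltn0Sn n) i.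
move=> j; rewrite inE => /eqP ->; split; first by rewrite /= ltnn.
by exists [set i] => //; rewrite setTI.
Qed.

Lemma layer_past_slots n D B : layer_past n B ->
  P (B `&` X n.+1 @^-1` D) = P B * P (X n.+1 @^-1` D).
Proof.
move=> nB.
have := @mutually_independent_sigma _ _ _ P _ (layer_sigma s X h)
  _ [:: inl (inr n)] (fun=> X n.+1 @^-1` D) B layer_sigma_measurable
  layer_sigmaI layer_sigmaT (layer_independent hm) _ _ nB.
rewrite bigcap_seq !big_seq1 => ->//.
move=> j; rewrite inE => /eqP ->; split; first by rewrite /= ltnn.
by exists D => //; rewrite setTI.
Qed.

Section gains.
Context (m : nat).

(** The list of gains is deterministic here; a random selection reduces to it once the value of the
    index is fixed. *)
Definition gains_along (e : 'I_m -> J) (n : nat) (w : Omega) : m.-tuple R[i] :=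
  [tuple h n (e j) w | j < m].

Lemma measurable_gains_along e n : measurable_fun setT (gains_along e n).
Proof.
apply/measurable_fun_tnthP => j.
rewrite (_ : _ \o _ = h n (e j)); first exact: measurable_funP.
by apply/funext => w; rewrite /= tnth_mktuple.
Qed.

Lemma sigma_gains_along (F : set_system Omega) e n :
  sigma_algebra setT F ->
  (forall j D, measurable D -> F (h n (e j) @^-1` D)) ->
  forall D, measurable D -> F (gains_along e n @^-1` D).
Proof.
move=> sF FH D mD.
suff : D \in [set D | F (gains_along e n @^-1` D)] by rewrite inE.
rewrite inE; move: D mD; apply: smallest_sub.
  split => /=.
  - by rewrite preimage_set0; case: sF.
  - by move=> A FA; rewrite setTD preimage_setC -setTD; case: sF => _ + _; apply.
  - by move=> A FA; rewrite preimage_bigcup; case: sF => _ _; apply.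
move=> A; rewrite -bigcup_seq => -[j _ [B mB <-]] /=.
rewrite setTI -comp_preimage (_ : _ \o _ = h n (e j)); first exact: FH.
by apply/funext => w; rewrite /= tnth_mktuple.
Qed.

(** The right side refers to time 1, so it does not depend on [n]. The set [D] is arbitrary, not
    just the past, because the index [s n.+1] will have to be included. *)
Lemma gains_along_box (e : 'I_m -> J) n (D : set (nat + nat + nat * J)) B
    (C : 'I_m -> set R[i]) :
  injective e -> (forall j, ~ D (inr (n, e j))) ->
  <<s \bigcup_(i in D) layer_sigma s X h i >> B ->
  (forall j, measurable (C j)) ->
  P (B `&` gains_along e n.+1 @^-1` [set t | forall j, C j (tnth t j)]) =
  P B * \prod_(j < m) P (h 1 (e j) @^-1` C j).
Proof.
move=> ie De DB mC.
(* This defines an event for every index without inverting [e]; by injectivity the intersection has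
   a single term. *)
pose A (i : nat + nat + nat * J) := if i is inr (_, x) then
  \bigcap_(j in [set j | e j = x]) (h n.+1 (e j) @^-1` C j) else setT.
have AE j : A (inr (n, e j)) = h n.+1 (e j) @^-1` C j.
  rewrite /A (_ : [set _ | _] = [set j]) ?bigcap_set1//.
  by apply/seteqP; split => [x /= /ie|x ->].
have := @mutually_independent_sigma _ _ _ P _ (layer_sigma s X h)
  D [seq inr (n, e j) | j <- enum 'I_m] A B layer_sigma_measurable
  layer_sigmaI layer_sigmaT (layer_independent hm) _ _ DB.
rewrite big_map big_enum/= (_ : \bigcap_(j in _) _ =
    gains_along e n.+1 @^-1` [set t | forall j, C j (tnth t j)]); last first.
  apply/seteqP; split => w /= H.
    move=> j; rewrite tnth_mktuple.
    have := H (inr (n, e j)); rewrite AE; apply.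
    by rewrite /= map_f// mem_enum.
  move=> _ /= /mapP[j _ ->]; rewrite AE.
  by have := H j; rewrite tnth_mktuple.
move=> ->. 
- congr (_ * _); apply: eq_big => // j _.
  rewrite -[X in P X = _]/(A (inr (n, e j))) AE.
  by apply: (@circular_gaussian_law_unique _ _ _ _ _ _ v) => //;
    exact: (layer_gaussian hm).
- by rewrite map_inj_uniq ?enum_uniq// => x y [/ie].
- move=> _ /mapP[j _ ->]; split; [exact: De|rewrite AE].
  by exists (C j); rewrite ?setTI.
Qed.

(** Both sides are finite measures in [S], and boxes are a pi-system generating the sigma-algebra of
    tuples. *)
Lemma gains_along_law (e : 'I_m -> J) n (D : set (nat + nat + nat * J)) B S :
  injective e -> (forall j, ~ D (inr (n, e j))) ->
  <<s \bigcup_(i in D) layer_sigma s X h i >> B -> measurable S ->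
  P (B `&` gains_along e n.+1 @^-1` S) = P B * P (gains_along e 1 @^-1` S).
Proof.
move=> ie De DB mS.
have mB : measurable B.
  move: DB; apply: smallest_sub; first exact: sigma_algebra_measurable.
  by move=> A [i _]; exact: layer_sigma_measurable.
pose r : {nonneg R} := NngNum (fine_ge0 (measure_ge0 P B)).
have PBr : P B = r%:num%:E by rewrite /= fineK// fin_num_measure.
have mG1 := measurable_gains_along e n.+1.
have mG2 := measurable_gains_along e 1.
pose m1 : {measure set (m.-tuple R[i]) -> \bar R} :=
  measure_function_pushforward__canonical__measure_function_Measure (mrestr P mB) mG1.
pose m2 : {measure set (m.-tuple R[i]) -> \bar R} := mscale r
  (measure_function_pushforward__canonical__measure_function_Measure P mG2).
have m1E E : m1 E = P (B `&` gains_along e n.+1 @^-1` E).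
  by rewrite setIC.
have m2E E : m2 E = P B * P (gains_along e 1 @^-1` E).
  by rewrite PBr.
rewrite -m1E -m2E.
pose G : set_system (m.-tuple R[i]) := [set S | exists C : 'I_m -> set R[i],
  (forall j, measurable (C j)) /\ S = [set t | forall j, C j (tnth t j)]].
have G1 C : (forall j, measurable (C j)) -> G [set t | forall j, C j (tnth t j)].
  by move=> mC; exists C.
have GT : G setT.
  by exists (fun=> setT); split => //; apply/seteqP; split.
apply: (@g_sigma_algebra_measure_unique _ _ _ G _ (fun=> setT) _ _ m1 m2) => //.
- move=> _ [C [mC ->]].
  rewrite (_ : [set t | _] =
      \bigcap_(j in [set` enum 'I_m]) ((fun t => tnth t j) @^-1` C j)).
    rewrite bigcap_seq; apply: bigsetI_measurable => j _.
    by rewrite -[X in measurable X]setTI; exact: measurable_tnth.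
  apply/seteqP; split => t /= H j; first by move=> _; exact: H.
  by apply: H; rewrite /= mem_enum.
- by rewrite bigcup_const//; exists 0%N.
- move=> _ _ [C [mC ->]] [C' [mC' ->]].
  exists (fun j => C j `&` C' j); split; first by move=> j; exact: measurableI.
  apply/seteqP; split => t /=; first by move=> [H H'] j; split.
  by move=> H; split => j; case: (H j).
- move=> _ [C [mC ->]].
  rewrite m1E m2E (gains_along_box ie De DB mC).
  congr (_ * _).
  (* The box formula at time 1 with the full space as past turns the product of probabilities back
     into the probability of the box. *)
  have := @gains_along_box e 0 set0 setT C ie _ _ mC.
  rewrite setTI probability_setT mul1e => H; apply/esym/H; first by move=> j [].
  have [s0 sC _] := smallest_sigma_algebra setT
    (\bigcup_(i in set0) layer_sigma s X h i).
  by have := sC _ s0; rewrite setD0.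
- by move=> _; rewrite m1E preimage_setT setIT -ge0_fin_numE// fin_num_measure.
- move: mS; apply: smallest_sub; first exact: smallest_sigma_algebra.
  move=> A; rewrite -bigcup_seq => -[j _ [C mC <-]]; rewrite setTI.
  apply: sub_sigma_algebra; exists (fun i => if i == j then C else setT).
  split; first by move=> i; case: ifP.
  apply/seteqP; split => t /= H; first by move=> i; case: eqP => // ->.
  by have := H j; rewrite eqxx.
Qed.

End gains.
End layer.

Lemma measurable_fun_switch d d' (A : measurableType d) (V : measurableType d')
    k (sigma : A -> 'I_k) (F : 'I_k -> A -> V) :
  (forall i, measurable (sigma @^-1` [set i])) ->
  (forall i, measurable_fun setT (F i)) ->
  measurable_fun setT (fun x => F (sigma x) x).
Proof.
move=> ms mF _ D mD; rewrite setTI.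
rewrite (_ : _ @^-1` D = \big[setU/set0]_(i <- index_enum 'I_k)
    (sigma @^-1` [set i] `&` F i @^-1` D)).
  apply: bigsetU_measurable => i _; apply: measurableI => //.
  by rewrite -[X in measurable X]setTI; exact: mF.
rewrite -bigcup_seq; apply/seteqP; split => w.
  by move=> Dw; exists (sigma w); [rewrite /= mem_index_enum|split].
by move=> [i _ [/= <-]].
Qed.

(** * Geometric series and means over one observation *)

Section geometric.
Context (R : realType) (q : R) (q0 : 0 < q) (q1 : q <= 1).

Let Nq : `|1 - q| < 1.
Proof. by rewrite ger0_norm ?subr_ge0// ltrBlDr ltrDl. Qed.

Lemma nneseries_geometric :
  (\sum_(j <oo) ((1 - q) ^+ j)%:E = (q^-1)%:E)%E.
Proof.
apply/cvg_lim => //.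
have := @cvg_geometric_series R 1 (1 - q) Nq.
rewrite opprB addrCA subrr addr0 mul1r => H.
apply/fine_cvgP; split.
  by apply: nearW => j; apply/sum_fin_numP => i _ _.
apply: cvg_trans H; apply: near_eq_cvg; apply: nearW => j.
rewrite /= /series /= sumEFin /=.
by apply: eq_bigr => i _; rewrite mul1r.
Qed.

(** Serves two null events: a slot count equal to 0, and never stopping. *)
Lemma le_geometric_eq0 (x : \bar R) :
  (0 <= x -> (forall j, x <= ((1 - q) ^+ j)%:E) -> x = 0)%E.
Proof.
move=> x0 xle; apply/eqP; rewrite eq_le x0 andbT.
have c0 : (((1 - q) ^+ l)%:E @[l --> \oo] --> 0)%E.
  apply/fine_cvgP; split; first exact: nearW.
  have := @cvg_geometric R 1 (1 - q) Nq; rewrite /geometric /=.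
  by under eq_fun do rewrite mul1r.
by apply: cvge_ge c0; exact: nearW.
Qed.
End geometric.

Lemma nneseries_ltn (R : realType) (u : nat -> \bar R) n :
  (forall i, 0 <= u i)%E ->
  (\sum_(i <oo) (if (i < n)%N then u i else 0) = \sum_(0 <= i < n) u i)%E.
Proof.
move=> u0; rewrite (nneseries_split 0 n) => [|i _]; last by case: ifP.
rewrite add0n [X in (_ + X)%E]eseries0 ?adde0.
  by rewrite !big_nat; apply: eq_bigr => i /andP[_ ->].
by move=> i ni _; rewrite ltnNge ni.
Qed.

Section layer_means.
Local Open Scope ereal_scope.
Context d (Omega : measurableType d) (R : realType) (P : probability Omega R).
Context (k : nat) (J : choiceType) (s : nat -> Omega -> 'I_k).
Context (X : nat -> {RV P >-> nat}) (h : nat -> J -> {RV P >-> R[i]}).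
Context (p v : R) (hm : layer_model s X h p v).

Section selected_gains.
Context (m : nat) (e : 'I_k -> 'I_m -> J).

(* [e i] lists the gains revealed when the index [i] is selected: the single gain
   [i] in the sub-layer, the row [(i, 1), ..., (i, L)] in the main layer. *)
Definition selected_gains (n : nat) (w : Omega) : m.-tuple R[i] :=
  gains_along h (e (s n w)) n w.

Lemma selected_gainsE n (D : set (m.-tuple R[i])) :
  selected_gains n @^-1` D = \big[setU/set0]_(i <- index_enum 'I_k)
    (s n @^-1` [set i] `&` gains_along h (e i) n @^-1` D).
Proof.
rewrite -bigcup_seq; apply/seteqP; split => w.
  by move=> Dw; exists (s n w); [rewrite /= mem_index_enum|split].
by move=> [i _ [/= <-]].
Qed.

Lemma sigma_selected_gains n D : measurable D ->
  layer_past s X h n.+1 (selected_gains n.+1 @^-1` D).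
Proof.
move=> mD; rewrite selected_gainsE.
pose T := g_sigma_algebraType
  (\bigcup_(i in [set i | (@layer_time J i < n.+1)%N]) layer_sigma s X h i).
apply: (@bigsetU_measurable _ T) => i _; apply: (@measurableI _ T).
  apply: sub_sigma_algebra; exists (inl (inl n)) => //=.
  by exists [set i] => //; rewrite setTI.
apply: sigma_gains_along mD; first exact: smallest_sigma_algebra.
move=> j D' mD'; apply: sub_sigma_algebra; exists (inr (n, e i j)) => //=.
by exists D' => //; rewrite setTI.
Qed.

Lemma measurable_selected_gains n : measurable_fun setT (selected_gains n.+1).
Proof.
move=> _ D mD; rewrite setTI.
apply: (layer_past_measurable hm); exact: sigma_selected_gains.
Qed.

Context (phi : 'I_k -> m.-tuple R[i] -> \bar R).
Hypotheses (ie : forall i, injective (e i))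
  (mphi : forall i, measurable_fun setT (phi i)) (phi0 : forall i t, 0 <= phi i t).

Lemma measurable_selected n :
  measurable_fun setT (fun w => phi (s n.+1 w) (selected_gains n.+1 w)).
Proof.
apply: (measurable_fun_switch (F := fun i w => phi i (selected_gains n.+1 w))).
  by move=> i; exact: (measurable_index hm).
by move=> i; apply: measurableT_comp => //; exact: measurable_selected_gains.
Qed.

(** An average over the uniform index with the gains taken at time 1. Neither the time nor the past
    occurs in it, which is the source of stationarity. *)
Definition selected_mean : \bar R :=
  \sum_(i < k) (k%:R^-1)%:E * \int[P]_w phi i (gains_along h (e i) 1 w).

(** Split [B] along the value i of the index: on each piece the gains are those of the deterministic
    list [e i], and the piece has probability P B / k. *)
Lemma integral_selected n B : layer_past s X h n B ->
  \int[P]_(w in B) phi (s n.+1 w) (selected_gains n.+1 w) =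
  selected_mean * P B.
Proof.
move=> nB; have mB := layer_past_measurable hm nB.
have mS i : measurable (B `&` s n.+1 @^-1` [set i]).
  by apply: measurableI => //; exact: (measurable_index hm).
have BE : B = \big[setU/set0]_(i <- index_enum 'I_k) (B `&` s n.+1 @^-1` [set i]).
  rewrite -bigcup_seq; apply/seteqP; split => w.
    by move=> Bw; exists (s n.+1 w); [rewrite /= mem_index_enum|split].
  by move=> [i _ []].
rewrite [in LHS]BE ge0_integral_bigsetU//; first last.
- by apply: measurable_funTS; exact: measurable_selected.
- by move=> i j _ _ [w [[_ /= <-] [_ /= <-]]].
- exact: index_enum_uniq.
rewrite /selected_mean ge0_sume_distrl; last first.
  by move=> i _; rewrite mule_ge0// integral_ge0.
apply: eq_bigr => i _.
transitivity (\int[P]_(w in B `&` s n.+1 @^-1` [set i])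
    phi i (gains_along h (e i) n.+1 w)).
  by apply: eq_integral => w; rewrite inE => -[_ /= si]; rewrite /selected_gains si.
rewrite (@eq_law_integral _ _ _ _ _ _ _ _ (gains_along h (e i) 1)
  (P (B `&` s n.+1 @^-1` [set i])))//.
- by rewrite (layer_past_index hm)// [P B * _]muleC -!muleA [P B * _]muleC.
- exact: measurable_gains_along.
- exact: measurable_gains_along.
- exact: fin_num_measure.
(* The piece also depends on the index at time [n.+1], so this generator is added to the past; the
   gains of that time stay outside. *)
move=> D mD; apply: (gains_along_law hm
  (D := [set x | (layer_time x < n)%N \/ x = inl (inl n)])) => //.
  by move=> j [|//]; rewrite /= ltnn.
pose F := \bigcup_(x in [set x | (@layer_time J x < n)%N \/ x = inl (inl n)])
  layer_sigma s X h x.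
apply: (@measurableI _ (g_sigma_algebraType F)).
  move: B nB {mB mS BE}; apply: smallest_sub; first exact: smallest_sigma_algebra.
  by move=> B [x /= xn FB]; apply: sub_sigma_algebra; exists x => //; left.
apply: sub_sigma_algebra; exists (inl (inl n)); first by right.
by exists [set i] => //; rewrite setTI.
Qed.

End selected_gains.

Section slots.
Hypothesis p0 : (0 < p)%R.

Let p1 : (p <= 1)%R.
Proof.
have := layer_geometric hm (ltn0Sn 0) (ltn0Sn 0); rewrite expr0 mulr1 => pE.
rewrite -lee_fin -pE; apply: probability_le1.
by rewrite -[X in measurable X]setTI; exact: measurable_funP.
Qed.

Let q0 : (0 <= 1 - p)%R. Proof. by rewrite subr_ge0. Qed.

Let mX n D : measurable (X n @^-1` D).
Proof. by rewrite -[X in measurable X]setTI; exact: measurable_funP. Qed.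

Let slots_between n j : (0 < n)%N ->
  P (X n @^-1` [set i | (0 < i <= j)%N]) = (1 - (1 - p) ^+ j)%:E.
Proof.
move=> n0; elim: j => [|j ih].
  rewrite (_ : [set i | _] = set0); last first.
    by apply/seteqP; split => // i /=; rewrite leqn0 => /andP[]; case: i.
  by rewrite preimage_set0 measure0 expr0 subrr.
rewrite (_ : [set i | _] = [set i | (0 < i <= j)%N] `|` [set j.+1]); last first.
  apply/seteqP; split => i /=.
    by rewrite (leq_eqVlt i) ltnS => /andP[-> /orP[/eqP->|->]]; [right|left].
  by move=> [/andP[-> /leqW->]//|->]; rewrite leqnn.
rewrite preimage_setU measureU//; last first.
  by apply/seteqP; split => // w [/= /andP[_ +] wj]; rewrite wj ltnn.
transitivity ((1 - (1 - p) ^+ j)%:E + (p * (1 - p) ^+ j)%:E).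
  by congr (_ + _); [exact: ih|exact: (layer_geometric hm n0)].
by rewrite -EFinD exprS; congr (_%:E); ring.
Qed.

(** [geometric_law] is silent about the value 0. Complements give P(X = 0) + P(X > l) = (1 - p)^l
    for every l, and letting l grow forces P(X = 0) = 0. *)
Let slots_tail n j : (0 < n)%N ->
  P (X n @^-1` [set i | (j < i)%N]) = ((1 - p) ^+ j)%:E.
Proof.
move=> n0.
have H l : P (X n @^-1` [set 0%N]) + P (X n @^-1` [set i | (l < i)%N]) =
    ((1 - p) ^+ l)%:E.
  rewrite -measureU//; last first.
    by apply/seteqP; split => // w [/= ->]; rewrite ltn0.
  have -> : X n @^-1` [set 0%N] `|` X n @^-1` [set i | (l < i)%N] =
      ~` (X n @^-1` [set i | (0 < i <= l)%N]).
    apply/seteqP; split => w /=.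
      by move=> [->|lw] /andP[]// _; rewrite leqNgt lw.
    by case: (X n w) => [|i]; [left|move/negP; rewrite /= -ltnNge; right].
  rewrite [LHS](probability_setC _ (mX n _)).
  transitivity (1 - (1 - (1 - p) ^+ l)%:E).
    by congr (_ - _); exact: slots_between.
  by rewrite -EFinB; congr (_%:E); ring.
suff P0 : P (X n @^-1` [set 0%N]) = 0 by rewrite -H P0 add0e.
apply: (le_geometric_eq0 p0 p1); first exact: measure_ge0.
by move=> l; rewrite -H leeDl.
Qed.

Lemma measurable_slots n : measurable_fun setT (fun w => (X n w)%:R%:E : \bar R).
Proof.
by apply/measurable_EFinP; apply: (measurableT_comp (f := fun i : nat => i%:R : R)).
Qed.

(** Sum of tails: X is the number of j with j < X, and each of these events is independent of
    [B]. *)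
Lemma integral_slots n B : layer_past s X h n B ->
  \int[P]_(w in B) (X n.+1 w)%:R%:E = (p^-1)%:E * P B.
Proof.
move=> nB; have mB := layer_past_measurable hm nB.
transitivity (\int[P]_(w in B)
    \sum_(j <oo) (\1_(X n.+1 @^-1` [set i | (j < i)%N]) w)%:E).
  apply: eq_integral => w _.
  transitivity (\sum_(j <oo) (if (j < X n.+1 w)%N then 1 else 0) : \bar R).
    rewrite nneseries_ltn// sumEFin big_const_nat subn0 iter_addr_0.
    by rewrite -mulr_natr mul1r.
  apply: eq_eseriesr => j _; rewrite indicE.
  by case: ifPn => H; [rewrite mem_set|rewrite memNset//; exact/negP].
rewrite integral_nneseries//; last first.
  by move=> j; apply: measurable_funTS; apply/measurable_EFinP; exact: measurable_indic.
transitivity (\sum_(j <oo) (P B * ((1 - p) ^+ j)%:E)).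
  apply: eq_eseriesr => j _; rewrite integral_indic//= setIC.
  by rewrite (layer_past_slots hm)// slots_tail.
have -> : P B = (fine (P B))%:E by rewrite fineK// fin_num_measure.
rewrite nneseriesZl//; last by move=> j _; rewrite lee_fin exprn_ge0.
by rewrite muleC nneseries_geometric.
Qed.

End slots.
End layer_means.

(** * Stopping times *)

Lemma first_timeP d (Omega : measurableType d) (Q : nat -> pred Omega) w n :
  first_time Q w = Some n <->
  [/\ (0 < n)%N, Q n w & forall j, (0 < j < n)%N -> ~~ Q j w].
Proof.
rewrite /first_time; case: pselect => [ex|nex]; last first.
  by split => // -[n0 Qn _]; exfalso; apply: nex; exists n; rewrite n0.
case: ex_minnP => m /andP[m0 Qm] mmin; split.
  move=> [<-]; split => // j /andP[j0 jm]; apply/negP => Qj.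
  by have := mmin j; rewrite j0 Qj => /(_ isT); rewrite leqNgt jm.
move=> [n0 Qn nmin]; congr Some; apply/eqP; rewrite eqn_leq.
rewrite mmin ?n0//= leqNgt; apply/negP => mn.
by have := nmin m; rewrite m0 mn Qm => /(_ isT).
Qed.

Section stopped.
Local Open Scope ereal_scope.
Context d (A : measurableType d) (R : realType) (N : A -> option nat).
Hypothesis mN : forall n, measurable [set a | N a = Some n].

Lemma measurable_None : measurable [set a | N a = None].
Proof.
rewrite (_ : [set a | _] = ~` \bigcup_n [set a | N a = Some n]).
  by apply: measurableC; exact: bigcupT_measurable.
apply/seteqP; split => w /=; first by move=> wN [n _]; rewrite /= wN.
by case E : (N w) => [n|]// nN; exfalso; apply: nN; exists n.
Qed.

Lemma measurable_stopped (Z : nat -> A -> \bar R) :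
  (forall a, N a != Some 0%N) -> (forall n, measurable_fun setT (Z n.+1)) ->
  measurable_fun setT (stopped Z N).
Proof.
move=> N0 mZ _ D mD; rewrite setTI.
rewrite (_ : stopped Z N @^-1` D = ([set w | N w = None] `&` [set w | D 0]) `|`
    \bigcup_n ([set w | N w = Some n.+1] `&` Z n.+1 @^-1` D)).
  apply: measurableU.
    apply: measurableI; first exact: measurable_None.
    have [D0|nD0] := pselect (D 0).
      by rewrite (_ : [set w | _] = setT)//; apply/seteqP; split.
    by rewrite (_ : [set w | _] = set0)//; apply/seteqP; split.
  apply: bigcupT_measurable => n; apply: measurableI => //.
  by rewrite -[X in measurable X]setTI; exact: mZ.
apply/seteqP; split => w; rewrite /stopped /=.
  case E : (N w) => [[|n]|] Dw; [|right|left] => //.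
    by have := N0 w; rewrite E.
  by exists n.
by move=> [[-> //]|[n _ [/= ->]]].
Qed.

End stopped.

Section stopping.
Local Open Scope ereal_scope.
Context d (Omega : measurableType d) (R : realType) (P : probability Omega R).
Context (F : nat -> set_system Omega).
Hypotheses (sF : forall n, sigma_algebra setT (F n))
  (mF : forall n, F n `<=` measurable) (leF : forall n, F n `<=` F n.+1).

(* The event N > n; [None], i.e. never stopping, counts as infinity. *)
Definition not_before (N : Omega -> option nat) (n : nat) : set Omega :=
  [set w | if N w is Some j then (n < j)%N else true].

(** The expectation of N as the sum of its tails P(N > n), the form in which Wald's identity
    produces it; it may be infinite. *)
Definition mean_stop (N : Omega -> option nat) : \bar R :=
  \sum_(n <oo) P (not_before N n).

Let leF_leq i n : (i <= n)%N -> F i `<=` F n.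
Proof.
move=> /subnKC <-; elim: (n - i)%N => [|m ih]; rewrite ?addn0// addnS.
exact: subset_trans ih (@leF _).
Qed.

Let FC n A : F n A -> F n (~` A).
Proof. by move=> FA; rewrite -setTD; have [_ + _] := sF n; apply. Qed.

Let F0 n : F n set0.
Proof. by have [] := sF n. Qed.

Let FU n (A : nat -> set Omega) : (forall i, F n (A i)) -> F n (\bigcup_i A i).
Proof. by have [_ _] := sF n; apply. Qed.

(** Whether observation n + 1 is made is decided by the first n. Wald's identity rests on this. *)
Lemma not_before_F (N : Omega -> option nat) n :
  (forall n, F n [set w | N w = Some n]) -> F n (not_before N n).
Proof.
move=> FN; rewrite (_ : not_before N n = ~` \bigcup_i
    (if (i <= n)%N then [set w | N w = Some i] else set0)).
  apply: FC; apply: FU => i; case: ifP => // ni.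
  by apply: (leF_leq ni); exact: FN.
apply/seteqP; split => w; rewrite /not_before /=.
  case E : (N w) => [j|] + [i _]; case: ifP => //= ni; rewrite E// => nj [ji].
  by move: nj; rewrite ji ltnNge ni.
case E : (N w) => [j|//] nU; rewrite ltnNge; apply/negP => jn.
by apply: nU; exists j => //; rewrite jn.
Qed.

Lemma F_first_time (Q : nat -> pred Omega) n :
  (forall n, F n.+1 [set w | Q n.+1 w]) ->
  F n [set w | first_time Q w = Some n].
Proof.
move=> FQ; case: n => [|n].
  rewrite (_ : [set w | _] = set0)//.
  by apply/seteqP; split => // w /= /first_timeP[].
rewrite (_ : [set w | _] = ~` (~` [set w | Q n.+1 w] `|`
    \bigcup_i (if (i < n)%N then [set w | Q i.+1 w] else set0))).
  apply: FC; rewrite -bigcup2E; apply: FU => -[|[|i]] /=.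
  - exact/FC.
  - apply: FU => i; case: ifP => // ni.
    by apply: (@leF_leq i.+1); [exact: ltnW|exact: FQ].
  - exact: F0.
apply/seteqP; split => w /=.
  move=> /first_timeP[_ Qn nQ] [//|[i _]]; case: ifP => //= ni Qi.
  by have := nQ i.+1; rewrite !ltnS ni Qi => /(_ isT).
move=> /not_orP[/contrapT Qn nQ]; apply/first_timeP; split => // -[//|j].
rewrite !ltnS /= => jn; apply/negP => Qj; apply: nQ; exists j => //.
by rewrite jn.
Qed.

Section stopping_time.
Context (N : Omega -> option nat) (stN : stopping_time P F N).

Let F_not_before n : F n (not_before N n).
Proof. by apply: not_before_F; have [] := stN. Qed.

Lemma stopping_time_measurable n : measurable [set w | N w = Some n].
Proof. by have [_ FN _] := stN; exact: mF (FN n). Qed.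

Lemma stopping_time_None_measurable : measurable [set w | N w = None].
Proof. by apply: measurable_None => n; exact: stopping_time_measurable. Qed.

Lemma mean_stop_ge0 : 0 <= mean_stop N.
Proof. by apply: nneseries_ge0 => n _ _; exact: measure_ge0. Qed.

Lemma measurable_stopping (Z : nat -> Omega -> \bar R) :
  (forall n, measurable_fun setT (Z n.+1)) ->
  measurable_fun setT (stopped Z N).
Proof.
move=> mZ; apply: measurable_stopped => //; last by have [] := stN.
by move=> n; exact: stopping_time_measurable.
Qed.

Lemma integral_stopped_cst (a : \bar R) : 0 <= a ->
  \int[P]_w stopped (fun _ _ => a) N w = a.
Proof.
move=> a0; transitivity (\int[P]_w cst a w); last first.
  by rewrite integral_cst//= probability_setT mule1.
apply: ge0_ae_eq_integral => //.
- by apply: measurable_stopping => n; exact: measurable_cst.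
- by move=> w _; rewrite /stopped; case: (N w).
- exists [set w | N w = None]; split.
  + exact: stopping_time_None_measurable.
  + by have [] := stN.
  + move=> w /= /not_implyP[_]; rewrite /stopped; by case: (N w).
Qed.

(* Wald's identity *)
Lemma integral_stopped_sum (Z : nat -> Omega -> \bar R) (c : R) :
  (forall n, measurable_fun setT (Z n.+1)) -> (forall n w, 0 <= Z n w) ->
  (0 <= c)%R ->
  (forall n B, F n B -> \int[P]_(w in B) Z n.+1 w = c%:E * P B) ->
  \int[P]_w stopped (fun n w => \sum_(1 <= i < n.+1) Z i w) N w =
  c%:E * mean_stop N.
Proof.
move=> mZ Z0 c0 ZF; have [_ _ PN0] := stN.
have mN0 := stopping_time_None_measurable.
(* [stopped] is 0 on [None], while [not_before] contains [None]. Removing this null set makes sum_(i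
   <= N) Z_i = sum_n Z_(n+1) 1_(U n) hold everywhere; the series is then integrated term by term. *)
pose U n := not_before N n `\` [set w | N w = None].
have mU n : measurable (U n).
  by apply: measurableD => //; apply: (@mF n); exact: F_not_before.
transitivity (\int[P]_w \sum_(n <oo) (Z n.+1 \_ (U n)) w).
  apply: eq_integral => w _; rewrite /stopped; case E : (N w) => [j|].
    rewrite big_add1 /= -nneseries_ltn//; apply: eq_eseriesr => n _.
    rewrite patchE /U /not_before; case: ifPn => nj.
      by rewrite mem_set//=; split; rewrite /= E.
    by rewrite memNset// => -[] /=; rewrite E (negbTE nj).
  rewrite eseries0// => n _ _; rewrite patchE memNset// /U /=.
  by rewrite E => -[_]; apply.
rewrite integral_nneseries//; first last.
- by move=> n w _; apply: erestrict_ge0.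
- by move=> n; apply/(measurable_restrictT _ (mU n)); exact: measurable_funTS.
transitivity (\sum_(n <oo) (c%:E * P (not_before N n))).
  apply: eq_eseriesr => n _; rewrite -(ZF n); last exact: F_not_before.
  rewrite -integral_mkcond [RHS](ge0_negligible_integral mN0)//.
  - apply: (@mF n); exact: F_not_before.
  - by apply: measurable_funTS.
by rewrite nneseriesZl// => n _; exact: measure_ge0.
Qed.

End stopping_time.

(** Each failure multiplies the survival probability by 1 - q, whatever the past, so P(N > n) = (1 -
    q)^n. The sum is 1 / q, and the limit 0 shows that stopping is almost sure. *)
Lemma first_time_geometric (Q : nat -> pred Omega) (q : R) : (0 < q)%R ->
  (forall n, F n.+1 [set w | Q n.+1 w]) ->
  (forall n B, F n B -> P (B `&` [set w | Q n.+1 w]) = q%:E * P B) ->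
  stopping_time P F (first_time Q) /\ mean_stop (first_time Q) = (q^-1)%:E.
Proof.
move=> q0 FQ PQ.
have q1 : (q <= 1)%R.
  rewrite -lee_fin; have := PQ 0%N setT; rewrite probability_setT mule1 setTI.
  move=> <-; first by apply: probability_le1; exact: mF (FQ 0%N).
  by rewrite -setC0; exact: FC.
have fN n w : not_before (first_time Q) n w <->
    forall j, (0 < j <= n)%N -> ~~ Q j w.
  rewrite /not_before /=; case E : (first_time Q w) => [m|]; split => //.
  - move=> nm j /andP[j0 jn]; have /first_timeP[_ _] := E; apply.
    by rewrite j0 (leq_ltn_trans jn nm).
  - move=> H; have /first_timeP[m0 Qm _] := E; rewrite ltnNge; apply/negP => mn.
    by have := H m; rewrite m0 mn Qm => /(_ isT).
  - move=> _ j /andP[j0 _]; apply/negP => Qj.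
    move: E; rewrite /first_time; case: pselect => // nex _; apply: nex.
    by exists j; rewrite j0.
have F_not_before n : F n (not_before (first_time Q) n).
  by apply: not_before_F => m; exact: F_first_time.
have PU n : P (not_before (first_time Q) n) = ((1 - q) ^+ n)%:E.
  elim: n => [|n ih].
    rewrite (_ : not_before _ 0 = setT) ?probability_setT//.
    apply/seteqP; split => // w _; apply/fN => j.
    by rewrite leqn0 => /andP[]; case: j.
  rewrite (_ : not_before _ n.+1 =
      not_before (first_time Q) n `\` [set w | Q n.+1 w]).
    rewrite measureD; first last.
    - exact: le_lt_trans (probability_le1 P (mF (F_not_before n))) (ltry 1).
    - exact: mF (FQ n).
    - exact: mF (F_not_before n).
    transitivity (((1 - q) ^+ n)%:E - q%:E * ((1 - q) ^+ n)%:E).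
      by congr (_ - _); [exact: ih|rewrite -ih; exact: PQ].
    by rewrite -EFinM -EFinB exprS; congr (_%:E); ring.
  apply/seteqP; split => w.
    move=> /fN H; split.
      by apply/fN => j /andP[j0 jn]; apply: H; rewrite j0 leqW.
    by move=> /= Qn; have := H n.+1; rewrite leqnn Qn => /(_ isT).
  move=> [/fN H /= nQ]; apply/fN => j /andP[j0]; rewrite leq_eqVlt.
  move=> /orP[/eqP ->|jn]; first exact/negP.
  by apply: H; rewrite j0 -ltnS.
split; last by rewrite /mean_stop (eq_eseriesr (fun n _ => PU n)) nneseries_geometric.
split.
- by move=> w; apply/eqP => /first_timeP[].
- by move=> n; exact: F_first_time.
- apply: (le_geometric_eq0 q0 q1); first exact: measure_ge0.
  move=> j; rewrite -PU; apply: le_measure; rewrite ?inE.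
  + apply: measurable_None => n; apply: (@mF n); exact: F_first_time.
  + exact: mF (F_not_before j).
  + by move=> w /= wN; rewrite /not_before /= wN.
Qed.

End stopping.

(** The Lipschitz bound does the work of continuity. The final equivalence identifies superlevel
    sets, from which measurability of the root in a parameter will follow. *)
Lemma lipschitz_antitone_root (R : realType) (h : R -> R) (delta lo hi : R) :
  (forall c c', c <= c' -> h c' <= h c) ->
  (forall c c', c <= c' -> h c <= h c' + (c' - c)) ->
  delta <= h lo -> h hi < delta ->
  let theta := sup [set c | delta <= h c] in
  h theta = delta /\ forall c, (delta <= h c) = (c <= theta).
Proof.
move=> anti lip hlo hhi theta.
pose S := [set c | delta <= h c].
have hiS c : S c -> c <= hi.
  move=> Sc; rewrite leNgt; apply/negP => /ltW /anti.
  by rewrite leNgt (lt_le_trans hhi).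
have supS : has_sup S by split; [exists lo|exists hi].
have S_le c : S c -> c <= sup S by move=> Sc; apply: ub_le_sup => //; exists hi.
have h1 : delta <= h (sup S).
  (* A point of [S] closer to the supremum than the gap would have a value below [delta], by the
     Lipschitz bound. *)
  rewrite leNgt; apply/negP => hlt.
  have e0 : 0 < delta - h (sup S) by rewrite subr_gt0.
  have [c Sc] := sup_adherent e0 supS.
  have := lip _ _ (S_le _ Sc); move: Sc; rewrite /S /=; lra.
split; last first.
  move=> c; apply/idP/idP; first exact: S_le.
  by move=> /anti; exact: le_trans.
apply/eqP; rewrite eq_le h1 andbT leNgt; apply/negP => hgt.
(* Moving right by h(theta) - delta lowers [h] by at most that amount, so [S] would extend beyond
   its supremum. *)
have := lip (sup S) (sup S + (h (sup S) - delta)); rewrite lerDl subr_ge0 => /(_ h1).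
rewrite addrAC subrr add0r => H.
have : S (sup S + (h (sup S) - delta)) by rewrite /S /=; lra.
by move=> /S_le; rewrite gerDl subr_le0 leNgt hgt.
Qed.

(** * Stopping at a threshold: the bound and the case of equality *)

Section threshold.
Local Open Scope ereal_scope.
Context d (Omega : measurableType d) (R : realType) (P : probability Omega R).
Context (F : nat -> set_system Omega).
Hypotheses (sF : forall n, sigma_algebra setT (F n))
  (mF : forall n, F n `<=` measurable) (leF : forall n, F n `<=` F n.+1).
Context (Y : nat -> Omega -> R) (theta delta : R).
Hypotheses (mY : forall n, measurable_fun setT (Y n.+1))
  (Y0 : forall n w, (0 <= Y n w)%R) (delta0 : (0 <= delta)%R)
  (FY : forall n B, F n B ->
    \int[P]_(w in B) (Num.max (Y n.+1 w - theta) 0)%:E = delta%:E * P B).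
Context (N : Omega -> option nat) (stN : stopping_time P F N).

Let excess n w : \bar R := (Num.max (Y n w - theta) 0)%:E.
(* Adding b makes both sides nonnegative even when theta < 0. *)
Let b : R := `|theta|%R.

Let mexcess n : measurable_fun setT (excess n.+1).
Proof.
apply/measurable_EFinP; apply: measurable_maxr => //.
exact: measurable_funB.
Qed.

Let excess0 n w : 0 <= excess n w.
Proof. by rewrite lee_fin le_max lexx orbT. Qed.

Let b0 : (0 <= b)%R. Proof. exact: normr_ge0. Qed.

Let tb0 : (0 <= theta + b)%R.
Proof. by rewrite /b; have := ler_norm (- theta)%R; rewrite normrN; lra. Qed.

Let lhsE : \int[P]_w stopped (fun n w => (Y n w + b)%:E) N w =
  \int[P]_w (stopped Y N w)%:E + b%:E.
Proof.
rewrite -[in RHS](integral_stopped_cst mF stN (a := b%:E)) ?lee_fin ?b0//.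
rewrite -ge0_integralD//; first last.
- by apply: (measurable_stopping mF stN) => n; exact: measurable_cst.
- by move=> w _; rewrite /stopped; case: (N w) => //; rewrite lee_fin b0.
- rewrite (_ : (fun w => _) = stopped (fun n w => (Y n w)%:E) N).
    by apply: (measurable_stopping mF stN) => n; exact/measurable_EFinP.
  by apply/funext => w; rewrite /stopped; case: (N w).
- by move=> w _; rewrite /stopped; case: (N w) => [n|]; rewrite lee_fin.
by apply: eq_integral => w _; rewrite /stopped; case: (N w) => [n|]; rewrite ?adde0.
Qed.

Let mrhs : measurable_fun setT (stopped (fun n w =>
  (theta + b)%:E + \sum_(1 <= i < n.+1) excess i w) N).
Proof.
apply: (measurable_stopping mF stN) => n; apply: emeasurable_funD => //.
rewrite -[X in measurable_fun _ X]/(fun w => _).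
under eq_fun do rewrite big_add1/= big_mkord.
by apply: emeasurable_sum => i.
Qed.

Let rhsE : \int[P]_w stopped (fun n w =>
    (theta + b)%:E + \sum_(1 <= i < n.+1) excess i w) N w =
  theta%:E + delta%:E * mean_stop P N + b%:E.
Proof.
rewrite -(integral_stopped_sum sF mF leF stN mexcess excess0 delta0 FY).
rewrite addeAC -EFinD.
rewrite -[in RHS](integral_stopped_cst mF stN (a := (theta + b)%:E)) ?lee_fin ?tb0//.
rewrite -ge0_integralD//; first last.
- apply: (measurable_stopping mF stN) => n.
  under eq_fun do rewrite big_add1/= big_mkord.
  by apply: emeasurable_sum => i.
- by move=> w _; rewrite /stopped; case: (N w) => // n; exact: sume_ge0.
- by apply: (measurable_stopping mF stN) => n; exact: measurable_cst.
- by move=> w _; rewrite /stopped; case: (N w) => //; rewrite lee_fin tb0.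
by apply: eq_integral => w _; rewrite /stopped; case: (N w) => [n|]; rewrite ?adde0.
Qed.

Lemma integral_stopped_le :
  \int[P]_w (stopped Y N w)%:E <= theta%:E + delta%:E * mean_stop P N.
Proof.
rewrite -(@leeD2rE _ b%:E)// -lhsE -rhsE; apply: ge0_le_integral => //.
- move=> w _; rewrite /stopped; case: (N w) => // n.
  by rewrite lee_fin addr_ge0.
- by apply: (measurable_stopping mF stN) => n;
    apply/measurable_EFinP; exact: measurable_funD.
(* On [None] both sides are 0; otherwise the last summand alone is enough, the earlier ones being
   nonnegative. *)
- move=> w _; have [N0 _ _] := stN; rewrite /stopped.
  case E : (N w) => [[|n]|]//; first by have := N0 w; rewrite E.
  rewrite big_nat_recr//=; apply: (@le_trans _ _ ((theta + b)%:E + excess n.+1 w)).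
    by rewrite -EFinD lee_fin [leRHS]addrAC lerD2r -lerBlDl le_max lexx.
  by rewrite leeD2lE// leeDr// sume_ge0.
Qed.

Lemma integral_stopped_eq :
  (forall n w, N w = Some n -> (theta <= Y n w)%R /\
     forall j, (0 < j < n)%N -> (Y j w < theta)%R) ->
  \int[P]_w (stopped Y N w)%:E = theta%:E + delta%:E * mean_stop P N.
Proof.
move=> NY; have H : \int[P]_w (stopped Y N w)%:E + b%:E =
    theta%:E + delta%:E * mean_stop P N + b%:E.
  rewrite -lhsE -rhsE; apply: eq_integral => w _.
  have [N0 _ _] := stN; rewrite /stopped.
  case E : (N w) => [[|n]|]//; first by have := N0 w; rewrite E.
  have [tY Yt] := NY _ _ E.
  rewrite big_nat_recr//= big_nat big1 ?add0e.
    by rewrite /excess max_l ?subr_ge0// -EFinD; congr (_%:E); ring.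
  by move=> j jn; rewrite /excess max_r// subr_le0 ltW// Yt.
(* [b] is finite, so it cancels even if [mean_stop] is infinite. *)
by apply: le_anti; apply/andP; split; rewrite -(@leeD2rE _ b%:E)// H.
Qed.

End threshold.

(** * Second moment of a circular Gaussian variable *)

Section gaussian_moment.
Local Open Scope ereal_scope.
Context (R : realType) (v : R) (v0 : (0 < v)%R).

Let sg := Num.sqrt (v / 2).
Let sg' := Num.sqrt v.
Let C : R := (normal_peak sg / normal_peak sg')%R.
Let r : R := expR (- (2 * v)^-1)%R.

Let sg0 : sg != 0%R. Proof. by rewrite gt_eqF// sqrtr_gt0 divr_gt0. Qed.
Let sg'0 : sg' != 0%R. Proof. by rewrite gt_eqF// sqrtr_gt0. Qed.

(** The density of N(0, v/2) is proportional to exp(-x^2/v), that of N(0, v) to exp(-x^2/(2v)). Half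
    of the first exponent gives the second density, the other half is at most exp(-n/(2v)) =
    [r ^+ n]; [C] is the ratio of the normalizing constants. *)
Let pdf_tail n (x : R) : (n%:R <= x ^+ 2)%R ->
  (normal_pdf 0 sg x <= C * r ^+ n * normal_pdf 0 sg' x)%R.
Proof.
move=> nx; rewrite !normal_pdfE//=.
have -> : (C * r ^+ n * (normal_peak sg' * normal_fun 0 sg' x) =
    normal_peak sg * (r ^+ n * normal_fun 0 sg' x))%R.
  by rewrite /C; field; rewrite gt_eqF// normal_peak_gt0.
rewrite ler_wpM2l ?normal_peak_ge0// /normal_fun /r -expRM_natl -expRD.
rewrite ler_expR !subr0 !sqr_sqrtr ?divr_ge0 ?(ltW v0)//.
have v2 : (0 < (2 * v)^-1)%R by rewrite invr_gt0 mulr_gt0.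
have -> : (- x ^+ 2 / (v / 2 *+ 2) = - (2 * v)^-1 * (x ^+ 2 + x ^+ 2))%R.
  by rewrite -mulr_natr; field; rewrite gt_eqF.
have -> : (n%:R * - (2 * v)^-1 + - x ^+ 2 / (v *+ 2) = - (2 * v)^-1 * (n%:R + x ^+ 2))%R.
  by rewrite -(mulr_natr v 2); field; rewrite gt_eqF.
by rewrite ler_nM2l ?oppr_lt0// lerD2r.
Qed.

(* On {x^2 >= n} the density of N(0, v/2) is at most C r^n times that of N(0, v). *)
Lemma normal_prob_tail n :
  normal_prob (0 : R) (Num.sqrt (v / 2)) [set x | (n%:R <= x ^+ 2)%R] <=
  (C * r ^+ n)%:E.
Proof.
have mA : measurable [set x : R | (n%:R <= x ^+ 2)%R].
  rewrite (_ : [set x | _] = (fun x : R => x ^+ 2)%R @^-1` `[n%:R, +oo[).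
    by rewrite -[X in measurable X]setTI; exact: measurable_funX.
  by apply/seteqP; split => x /=; rewrite in_itv/= andbT.
have C0 : (0 <= C * r ^+ n)%R.
  by rewrite mulr_ge0 ?exprn_ge0 ?expR_ge0// divr_ge0 ?normal_peak_ge0.
rewrite /normal_prob.
apply: (@le_trans _ _ (\int[lebesgue_measure]_(x in [set x : R | (n%:R <= x ^+ 2)%R])
    ((C * r ^+ n)%:E * (normal_pdf 0 sg' x)%:E))).
  apply: ge0_le_integral => //.
  - by move=> x _; rewrite lee_fin normal_pdf_ge0.
  - by apply/measurable_EFinP; apply: measurable_funTS; exact: measurable_normal_pdf.
  - apply: measurable_funTS; apply: measurable_funeM.
    by apply/measurable_EFinP; exact: measurable_normal_pdf.
  - by move=> x /= nx; rewrite -EFinM lee_fin pdf_tail.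
rewrite ge0_integralZl//; first last.
- by move=> x _; rewrite lee_fin normal_pdf_ge0.
- by apply/measurable_EFinP; apply: measurable_funTS; exact: measurable_normal_pdf.
rewrite -[leRHS]mule1; apply: lee_wpmul2l; first by rewrite lee_fin.
by rewrite -/(normal_prob 0 sg' _); exact: probability_le1.
Qed.

Context d (Omega : measurableType d) (P : probability Omega R).

(** Y^2 is at most the number of n >= 0 with n <= Y^2, and the tail bound makes the probabilities of
    these events summable. *)
Let sqr_moment (Y : Omega -> R) : measurable_fun setT Y ->
  (forall A, measurable A -> P (Y @^-1` A) = normal_prob 0 sg A) ->
  \int[P]_w (Y w ^+ 2)%:E < +oo.
Proof.
move=> mY lY.
have mA n : measurable [set w | (n%:R <= Y w ^+ 2)%R].
  rewrite (_ : [set w | _] = (fun w => Y w ^+ 2)%R @^-1` `[n%:R, +oo[).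
    by rewrite -[X in measurable X]setTI; exact: measurable_funX.
  by apply/seteqP; split => x /=; rewrite in_itv/= andbT.
have mB n : measurable [set x : R | (n%:R <= x ^+ 2)%R].
  rewrite (_ : [set x | _] = (fun x : R => x ^+ 2)%R @^-1` `[n%:R, +oo[).
    by rewrite -[X in measurable X]setTI; exact: measurable_funX.
  by apply/seteqP; split => x /=; rewrite in_itv/= andbT.
apply: (@le_lt_trans _ _ (\int[P]_w
    \sum_(n <oo) (\1_[set w | (n%:R <= Y w ^+ 2)%R] w)%:E)).
  apply: ge0_le_integral => //.
  - by move=> w _; rewrite lee_fin sqr_ge0.
  - by apply/measurable_EFinP; exact: measurable_funX.
  - apply: ge0_emeasurable_sum => // n _.
    by apply/measurable_EFinP; exact: measurable_indic.
  - move=> w _; have y0 := sqr_ge0 (Y w).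
    (* Every n from 0 to the integer part N counts, which gives N + 1 > Y^2 terms. *)
    pose N := Num.truncn (Y w ^+ 2).
    apply: (@le_trans _ _ (\sum_(n <oo) (if (n < N.+1)%N then
        (\1_[set w | (n%:R <= Y w ^+ 2)%R] w)%:E else 0))); last first.
      by apply: lee_nneseries => [n _ _|n _]; case: ifP => // _; rewrite lee_fin.
    rewrite nneseries_ltn//.
    have -> : \sum_(0 <= n < N.+1) (\1_[set w | (n%:R <= Y w ^+ 2)%R] w)%:E =
        \sum_(0 <= n < N.+1) (1 : \bar R).
      rewrite !big_nat; apply: eq_bigr => n /andP[_ nN].
      rewrite indicE mem_set//=; apply: (@le_trans _ _ N%:R).
        by rewrite ler_nat.
      by rewrite Num.Theory.truncn_le.
    rewrite sumEFin lee_fin big_const_nat subn0 iter_addr_0.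
    by rewrite ltW// truncnS_gt.
rewrite integral_nneseries//; last first.
  by move=> n; apply/measurable_EFinP; exact: measurable_indic.
apply: (@le_lt_trans _ _ (\sum_(n <oo) (C%:E * (r ^+ n)%:E))).
  apply: lee_nneseries => [n _ _|n _]; first exact: integral_ge0.
  rewrite integral_indic// setIT -EFinM; apply: le_trans (normal_prob_tail n).
  by rewrite -[leLHS]/(P (Y @^-1` [set x | (n%:R <= x ^+ 2)%R])) lY.
have r1 : (r < 1)%R by rewrite expR_lt1 oppr_lt0 invr_gt0 mulr_gt0.
have r0 : (0 < r)%R by exact: expR_gt0.
rewrite nneseriesZl; last by move=> n _; rewrite lee_fin exprn_ge0// ltW.
under eq_eseriesr do rewrite -[r](subKr 1).
by rewrite nneseries_geometric ?subr_gt0 ?gerBl ?ltW// -EFinM ltry.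
Qed.

Lemma circular_gaussian_sqr_moment (Z : {RV P >-> R[i]}) :
  circular_gaussian_law Z v ->
  \int[P]_w (ComplexField.Normc.normc (Z w) ^+ 2)%:E < +oo.
Proof.
move=> lZ.
have mR : measurable_fun setT (fun w => complex.Re (Z w)).
  by apply: (measurableT_comp (@measurable_Re R)); exact: measurable_funP.
have mI : measurable_fun setT (fun w => complex.Im (Z w)).
  by apply: (measurableT_comp (@measurable_Im R)); exact: measurable_funP.
rewrite (_ : (fun w => _) = fun w => (complex.Re (Z w) ^+ 2)%:E +
    (complex.Im (Z w) ^+ 2)%:E); last first.
  apply/funext => w; rewrite -EFinD /=; case: (Z w) => x y.
  by rewrite /= sqr_sqrtr// addr_ge0// sqr_ge0.
rewrite ge0_integralD//; last first.
- by apply/measurable_EFinP; exact: measurable_funX.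
- by move=> w _; rewrite lee_fin sqr_ge0.
- by apply/measurable_EFinP; exact: measurable_funX.
- by move=> w _; rewrite lee_fin sqr_ge0.
apply: lte_add_pinfty; apply: sqr_moment => // A mA.
  have := lZ A setT mA measurableT; rewrite probability_setT mule1 => <-.
  by congr (P _); apply/seteqP; split => w //= -[].
have := lZ setT A measurableT mA; rewrite probability_setT mul1e => <-.
by congr (P _); apply/seteqP; split => w //= -[].
Qed.
End gaussian_moment.

(** * Slot times and stationarity of the observations *)

Section layer_stopping.
Local Open Scope ereal_scope.
Context d (Omega : measurableType d) (R : realType) (P : probability Omega R).
Context (k : nat) (J : choiceType) (s : nat -> Omega -> 'I_k).
Context (X : nat -> {RV P >-> nat}) (h : nat -> J -> {RV P >-> R[i]}).

Lemma layer_past_sigma n : sigma_algebra setT (layer_past s X h n).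
Proof. exact: smallest_sigma_algebra. Qed.

Lemma layer_past_le n : layer_past s X h n `<=` layer_past s X h n.+1.
Proof.
apply: smallest_sub; first exact: smallest_sigma_algebra.
by move=> A [i /= im FA]; apply: sub_gen_smallest; exists i => //=; exact: ltnW.
Qed.

Section filtration.
Context d' (V : measurableType d') (O : nat -> Omega -> V).

Lemma filtration_sigma n : sigma_algebra setT (filtration s X O n).
Proof. exact: smallest_sigma_algebra. Qed.

Lemma filtration_le n : filtration s X O n `<=` filtration s X O n.+1.
Proof.
apply: smallest_sub; first exact: smallest_sigma_algebra.
move=> A [i /= /andP[i0 im] FA]; apply: sub_gen_smallest.
by exists i => //=; rewrite i0 leqW.
Qed.

Lemma filtration_observed n D : measurable D -> (0 < n)%N ->
  filtration s X O n (O n @^-1` D).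
Proof.
move=> mD n0; apply: sub_gen_smallest; exists n; first by rewrite /= n0 leqnn.
by right; exists D => //; rewrite setTI.
Qed.

Lemma filtration_index n i : (0 < n)%N -> filtration s X O n (s n @^-1` [set i]).
Proof.
move=> n0; apply: sub_gen_smallest; exists n; first by rewrite /= n0 leqnn.
by left; left; exists [set i] => //; rewrite setTI.
Qed.

(** Seeing more cannot invalidate a stopping time, so bounds proved for [layer_past] reach every
    admissible rule. *)
Lemma stopping_time_past N :
  (forall n D, measurable D -> layer_past s X h n.+1 (O n.+1 @^-1` D)) ->
  stopping_time P (filtration s X O) N -> stopping_time P (layer_past s X h) N.
Proof.
move=> mO [N0 FN PN]; split => // n.
by apply: (filtration_layer_past mO); exact: FN.
Qed.
End filtration.

Context (p v : R) (hm : layer_model s X h p v) (p0 : (0 < p)%R).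
Context (N : Omega -> option nat) (stN : stopping_time P (layer_past s X h) N).

Lemma measurable_slot_time (T tau : R) n :
  measurable_fun setT (slot_time X T tau n).
Proof.
apply: measurable_funD => //; apply: measurable_funM => //.
under eq_fun do rewrite big_add1/= big_mkord.
apply: measurable_sum => i; exact/measurable_EFinP/measurable_slots.
Qed.

Lemma slot_time_ge0 (T tau : R) n w : (0 < T)%R -> (0 < tau)%R ->
  (0 <= slot_time X T tau n w)%R.
Proof.
move=> T0 tau0; rewrite addr_ge0 ?divr_ge0 ?(ltW T0)// mulr_ge0 ?divr_ge0 ?(ltW tau0)//.
exact: sumr_ge0.
Qed.

(** Wald's identity for (tau / 2) X_n, whose mean is tau / (2 p). *)
Lemma integral_slot_time (T tau : R) : (0 < T)%R -> (0 < tau)%R ->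
  \int[P]_w (stopped (slot_time X T tau) N w)%:E =
  (T / 2)%:E + (tau / (2 * p))%:E * mean_stop P N.
Proof.
move=> T0 tau0.
have mF := @layer_past_measurable _ _ _ _ _ _ _ _ _ _ _ hm.
pose Z n w : \bar R := (tau / 2)%:E * (X n w)%:R%:E.
have mZ n : measurable_fun setT (Z n).
  by apply: measurable_funeM; exact: measurable_slots.
have Z0 n w : 0 <= Z n w.
  by rewrite mule_ge0// lee_fin// divr_ge0// ltW.
have T20 : 0 <= (T / 2)%:E by rewrite lee_fin divr_ge0// ltW.
rewrite -(@integral_stopped_sum _ _ _ _ _ layer_past_sigma mF layer_past_le _ stN Z).
- rewrite -[in RHS](integral_stopped_cst mF stN T20).
  rewrite -ge0_integralD//; first last.
  + apply: (measurable_stopping mF stN) => n.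
    under eq_fun do rewrite big_add1/= big_mkord.
    by apply: emeasurable_sum => i.
  + by move=> w _; rewrite /stopped; case: (N w) => // n; exact: sume_ge0.
  + by apply: (measurable_stopping mF stN) => n; exact: measurable_cst.
  + by move=> w _; rewrite /stopped; case: (N w).
  apply: eq_integral => w _; rewrite /stopped; case: (N w) => [n|]; rewrite ?adde0//.
  rewrite /slot_time EFinD; congr (_ + _).
  by rewrite EFinM -sumEFin ge0_sume_distrr.
- by move=> n; exact: mZ.
- exact: Z0.
- by rewrite divr_ge0 ?mulr_ge0 ?(ltW tau0)// ltW.
- move=> n B nB; rewrite ge0_integralZl//.
  + rewrite (integral_slots hm p0 nB) muleA -EFinM; congr (_%:E * _).
    by rewrite invfM mulrA.
  + exact: (mF _ _ nB).
  + by apply: measurable_funTS; exact: measurable_slots.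
  + by rewrite lee_fin divr_ge0// ltW.
Qed.

End layer_stopping.

Section selected_shift.
Local Open Scope ereal_scope.
Context d (Omega : measurableType d) (R : realType) (P : probability Omega R).
Context (k : nat) (J : choiceType) (s : nat -> Omega -> 'I_k).
Context (X : nat -> {RV P >-> nat}) (h : nat -> J -> {RV P >-> R[i]}).
Context (p v : R) (hm : layer_model s X h p v).
Context (m : nat) (e : 'I_k -> 'I_m -> J) (ie : forall i, injective (e i)).
Local Notation O := (selected_gains s h e).

(** Both integrals reduce to the same [selected_mean]; time [l.+1] is the reference observation at
    which the mean is known. *)
Lemma integral_selected_shift (phi : 'I_k -> m.-tuple R[i] -> \bar R) n l B :
  (forall i, measurable_fun setT (phi i)) -> (forall i t, 0 <= phi i t) ->
  layer_past s X h n B ->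
  \int[P]_(w in B) phi (s n.+1 w) (O n.+1 w) =
  (\int[P]_w phi (s l.+1 w) (O l.+1 w)) * P B.
Proof.
move=> mphi phi0 nB; have lT : layer_past s X h l setT.
  have [s0 sC _] := layer_past_sigma s X h l.
  by have := sC _ s0; rewrite setD0.
rewrite (integral_selected hm ie mphi phi0 nB).
rewrite [X in _ = X * _](integral_selected hm ie mphi phi0 lT).
by congr (_ * _); rewrite [X in _ = _ * X]probability_setT mule1.
Qed.

Lemma measurable_selected_event (A : 'I_k -> set (m.-tuple R[i])) n :
  (forall i, measurable (A i)) -> measurable [set w | A (s n.+1 w) (O n.+1 w)].
Proof.
move=> mA; rewrite -[X in measurable X]setTI.
have := @measurable_selected _ _ _ _ _ _ _ _ _ _ _ hm _ e
  (fun i t => (\1_(A i) t)%:E) _ n measurableT `]0%:E, +oo[%classic.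
rewrite (_ : _ @^-1` _ = [set w | A (s n.+1 w) (O n.+1 w)]).
  apply; first by move=> i; apply/measurable_EFinP; exact: measurable_indic.
  exact: emeasurable_itv.
by apply/seteqP; split => w /=;
  rewrite in_itv/= andbT indicE lte_fin ltr0n lt0b inE.
Qed.

Lemma selected_event_shift (A : 'I_k -> set (m.-tuple R[i])) n l B :
  (forall i, measurable (A i)) -> layer_past s X h n B ->
  P (B `&` [set w | A (s n.+1 w) (O n.+1 w)]) =
  P [set w | A (s l.+1 w) (O l.+1 w)] * P B.
Proof.
move=> mA nB.
have mB := layer_past_measurable hm nB.
have := @integral_selected_shift (fun i t => (\1_(A i) t)%:E) n l B.
have E j w : (\1_(A (s j w)) (O j w))%:E =
    (\1_[set w | A (s j w) (O j w)] w)%:E :> \bar R.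
  by rewrite !indicE; congr (_%:R%:E); apply/idP/idP; rewrite !inE.
under eq_integral do rewrite E.
under [X in X * _]eq_integral do rewrite E.
rewrite !integral_indic//; try exact: measurable_selected_event.
rewrite setIT setIC; apply => //.
by move=> i; apply/measurable_EFinP; exact: measurable_indic.
Qed.

End selected_shift.

(** Otherwise the positive part would vanish almost everywhere. Applied to reward minus threshold,
    this gives the threshold rule a positive success probability. *)
Lemma excess_event_gt0 d (Omega : measurableType d) (R : realType)
    (P : probability Omega R) (V : Omega -> R) (delta : R) :
  measurable_fun setT V -> 0 < delta ->
  (\int[P]_w (Num.max (V w) 0)%:E = delta%:E)%E ->
  (0 < P [set w | (0 <= V w)%R])%E.
Proof.
move=> mV delta0 VE.
have mA : measurable [set w | 0 <= V w].
  rewrite (_ : [set w | _] = V @^-1` `[0, +oo[).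
    by rewrite -[X in measurable X]setTI; exact: mV.
  by apply/seteqP; split => x /=; rewrite in_itv/= andbT.
rewrite lt0e measure_ge0 andbT; apply/eqP => PA.
move: VE; rewrite (ge0_negligible_integral mA)//.
- rewrite integral0_eq; first by move=> [] /eqP; rewrite lt_eqF.
  move=> w [_ /negP]; rewrite -ltNge => V0.
  by rewrite max_r// ltW.
- by apply/measurable_EFinP; exact: measurable_maxr.
- by move=> w _; rewrite lee_fin le_max lexx orbT.
Qed.

(** * The sub-layer problem *)

Section sub_layer.
Local Open Scope ereal_scope.
Context d (Omega : measurableType d) (R : realType) (P : probability Omega R).
Context (L : nat) (T tau Ps Pr : R) (s : nat -> Omega -> 'I_L).
Context (X : nat -> {RV P >-> nat}) (g : nat -> 'I_L -> {RV P >-> R[i]}).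
Context (p v gamma : R) (hm : layer_model s X g p v).
Hypotheses (p0 : (0 < p)%R) (T0 : (0 < T)%R) (tau0 : (0 < tau)%R)
  (Ps0 : (0 < Ps)%R) (Pr0 : (0 < Pr)%R) (gamma0 : (0 < gamma)%R).

Local Notation nsq z := (ComplexField.Normc.normc z ^+ 2)%R.
Local Notation Y := (sub_reward T Ps Pr s g).
Local Notation past := (layer_past s X g).
Let e : 'I_L -> 'I_1 -> 'I_L := fun i _ => i.
Let delta : R := (gamma * tau / (2 * p))%R.

Let delta0 : (0 < delta)%R.
Proof. by rewrite divr_gt0 ?mulr_gt0. Qed.

Let mF := layer_past_measurable hm.

Let ie i : injective (e i).
Proof. by move=> x y _; rewrite !ord1. Qed.

Definition reward_at (f : L.-tuple R[i]) (i : 'I_L) (z : R[i]) : R :=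
  (T / 2 * (ln (1 + Ps * Pr * nsq (tnth f i) * nsq z /
    (1 + Ps * nsq (tnth f i) + Pr * nsq z)) / ln 2))%R.

(** With x = Ps a and y = Pr b, ln(1 + xy / (1 + x + y)) <= xy / (1 + x + y) <= x. Summing over j
    removes the selected index, so the bound depends on [f] alone and is linear in the squared
    moduli. *)
Definition reward_bound (f : L.-tuple R[i]) : R :=
  (T / 2 * (Ps / ln 2) * \sum_(j < L) nsq (tnth f j))%R.

Let ln20 : (0 < ln 2 :> R)%R. Proof. by rewrite ln_gt0// ltr1n. Qed.

Lemma measurable_reward_at i : measurable_fun setT
  (fun x : L.-tuple R[i] * R[i] => reward_at x.1 i x.2).
Proof.
have ma : measurable_fun setT (fun x : L.-tuple R[i] * R[i] => nsq (tnth x.1 i)).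
  apply: (measurableT_comp (@measurable_normc_sqr R)).
  exact: (measurableT_comp (measurable_tnth i)).
have mb : measurable_fun setT (fun x : L.-tuple R[i] * R[i] => nsq x.2).
  exact: (measurableT_comp (@measurable_normc_sqr R)).
apply: measurable_funM => //; apply: measurable_funM => //.
apply: (measurableT_comp (@measurable_ln R)); apply: measurable_funD => //.
apply: measurable_funM.
  by apply: measurable_funM => //; apply: measurable_funM.
(* The denominator is nonnegative, so its inverse is the power -1, to which [measurable_powR]
   applies. *)
rewrite (_ : (fun x : L.-tuple R[i] * R[i] => _) = (fun x : L.-tuple R[i] * R[i] =>
    (1 + Ps * nsq (tnth x.1 i) + Pr * nsq x.2) `^ (-1))%R); last first.
  apply/funext => x; rewrite powR_inv1// !addr_ge0// mulr_ge0 ?sqr_ge0//.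
    exact: ltW.
  exact: ltW.
apply: (measurableT_comp (@measurable_powR R (-1))).
by apply: measurable_funD; [apply: measurable_funD|] => //; apply: measurable_funM.
Qed.

Let ratio_ge0 (a b : R) : (0 <= a -> 0 <= b ->
  0 <= Ps * Pr * a * b / (1 + Ps * a + Pr * b))%R.
Proof.
by move=> a0 b0; rewrite divr_ge0 ?addr_ge0 ?mulr_ge0 ?(ltW Ps0) ?(ltW Pr0).
Qed.

Lemma reward_at_ge0 f i z : (0 <= reward_at f i z)%R.
Proof.
rewrite mulr_ge0 ?divr_ge0 ?(ltW T0) ?(ltW ln20)// ln_ge0// lerDl.
exact: ratio_ge0 (sqr_ge0 _) (sqr_ge0 _).
Qed.

Lemma reward_at_le f i z : (reward_at f i z <= reward_bound f)%R.
Proof.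
have a0 := sqr_ge0 (ComplexField.Normc.normc (tnth f i)).
have b0 := sqr_ge0 (ComplexField.Normc.normc z).
rewrite /reward_at /reward_bound -[leRHS]mulrA ler_wpM2l ?divr_ge0 ?(ltW T0)//.
rewrite [leRHS]mulrAC ler_wpM2r ?invr_ge0 ?(ltW ln20)//.
have r0 := ratio_ge0 a0 b0.
apply: le_trans (le_ln1Dx _) _; first exact: lt_le_trans r0.
apply: (@le_trans _ _ (Ps * nsq (tnth f i))%R).
  have D0 : (0 < 1 + Ps * nsq (tnth f i) + Pr * nsq z)%R.
    rewrite -addrA; apply: ltr_pwDl => //.
    by apply: addr_ge0; apply: mulr_ge0 => //; exact: ltW.
  rewrite ler_pdivrMr//.
  have -> : (Ps * Pr * nsq (tnth f i) * nsq z =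
    (Ps * nsq (tnth f i)) * (Pr * nsq z))%R by ring.
  apply: ler_wpM2l; first by rewrite mulr_ge0 ?(ltW Ps0).
  by rewrite lerDr; apply: addr_ge0 => //; apply: mulr_ge0 => //; exact: ltW.
apply: ler_wpM2l; first exact: ltW.
rewrite (bigD1 i)//= lerDl; apply: sumr_ge0 => j _.
exact: sqr_ge0.
Qed.

Lemma reward_bound_ge0 f : (0 <= reward_bound f)%R.
Proof.
apply: mulr_ge0; first by rewrite mulr_ge0 ?divr_ge0 ?(ltW T0) ?(ltW Ps0) ?(ltW ln20).
by apply: sumr_ge0 => j _; exact: sqr_ge0.
Qed.

(** Joint measurability in the gains and the sub-layer outcome is what Fubini-Tonelli needs to make
    means over the outcome measurable in the gains. *)
Lemma measurable_sub_reward_joint n :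
  measurable_fun setT (fun x : L.-tuple R[i] * Omega => Y x.1 n.+1 x.2).
Proof.
apply: (measurable_fun_switch (sigma := fun x : L.-tuple R[i] * Omega => s n.+1 x.2)
  (F := fun i x => reward_at x.1 i (g n.+1 i x.2))).
  move=> i; rewrite (_ : _ @^-1` _ = snd @^-1` (s n.+1 @^-1` [set i]))//.
  rewrite -[X in measurable X]setTI; apply: measurable_snd => //.
  exact: (measurable_index hm).
move=> i.
apply: (measurableT_comp (measurable_reward_at i)
  (g := fun x : L.-tuple R[i] * Omega => (x.1, g n.+1 i x.2))).
apply: measurable_fun_pair => //.
by apply: (measurableT_comp (f := g n.+1 i)).
Qed.

Lemma measurable_sub_reward f n : measurable_fun setT (Y f n.+1).
Proof.
exact: (measurableT_comp (measurable_sub_reward_joint n)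
  (pair1_measurable f)).
Qed.

Lemma sub_reward_ge0 f n w : (0 <= Y f n w)%R.
Proof. exact: reward_at_ge0. Qed.

Lemma sub_reward_le f n w : (Y f n w <= reward_bound f)%R.
Proof. exact: reward_at_le. Qed.

Let mean_excess f c : \bar R := \int[P]_w (Num.max (Y f 1%N w - c) 0)%:E.

Let maxr_ge0 (x : R) : (0 <= Num.max x 0)%R.
Proof. by rewrite le_max lexx orbT. Qed.

Let measurable_excess f c n :
  measurable_fun setT (fun w => (Num.max (Y f n.+1 w - c) 0)%:E : \bar R).
Proof.
apply/measurable_EFinP; apply: measurable_maxr => //; apply: measurable_funB => //.
exact: measurable_sub_reward.
Qed.

Let mean_excess_fin f c : mean_excess f c \is a fin_num.
Proof.
rewrite ge0_fin_numE; last by apply: integral_ge0 => w _; rewrite lee_fin.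
apply: (@le_lt_trans _ _ (\int[P]_w (cst (reward_bound f + `|c|)%:E w))).
  apply: ge0_le_integral => //.
  - by move=> w _; rewrite lee_fin.
  - move=> w _; rewrite /= lee_fin ge_max addr_ge0 ?reward_bound_ge0// andbT.
    by rewrite lerD// ?sub_reward_le// -normrN ler_norm.
by rewrite integral_cst//= probability_setT mule1 ltry.
Qed.

Let h f c : R := fine (mean_excess f c).

Let hE f c : mean_excess f c = (h f c)%:E.
Proof. by rewrite fineK. Qed.

Let past_excess f c n B : past n B ->
  \int[P]_(w in B) (Num.max (Y f n.+1 w - c) 0)%:E = (h f c)%:E * P B.
Proof.
move=> nB; rewrite -hE.
pose phi (i : 'I_L) (t : 1.-tuple R[i]) : \bar R :=
  (Num.max (reward_at f i (tnth t ord0) - c) 0)%:E.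
have phiE m w : (Num.max (Y f m w - c) 0)%:E = phi (s m w) (selected_gains s g e m w).
  by rewrite /phi tnth_mktuple.
rewrite /mean_excess; under eq_integral do rewrite phiE.
under [X in _ = X * _]eq_integral do rewrite phiE.
apply: (integral_selected_shift hm ie) => // [i|i t]; last by rewrite lee_fin.
apply/measurable_EFinP; apply: measurable_maxr => //; apply: measurable_funB => //.
apply: (measurableT_comp (measurable_reward_at i)
  (g := fun t : 1.-tuple R[i] => (f, tnth t ord0))).
apply: measurable_fun_pair => //.
exact: measurable_tnth.
Qed.

Definition sub_threshold f : R := sup [set c | (delta <= h f c)%R].

Let threshold_root f : h f (sub_threshold f) = delta /\
  forall c, (delta <= h f c)%R = (c <= sub_threshold f)%R.
Proof.
(* Rewards lie between 0 and [reward_bound f]: at c = -delta the excess is at least [delta]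
   everywhere, at the bound it is 0. *)
apply: (@lipschitz_antitone_root _ _ _ (- delta) (reward_bound f)).
- move=> c c' cc'; rewrite fine_le//; apply: ge0_le_integral => //.
  + by move=> w _; rewrite lee_fin.
  + by move=> w _; rewrite lee_fin le_max2 ?lerB.
- move=> c c' cc'; rewrite -lee_fin EFinD -!hE.
  have cc0 : 0 <= (c' - c)%:E by rewrite lee_fin subr_ge0.
  have -> : (c' - c)%:E = \int[P]_w cst (c' - c)%:E w.
    by rewrite integral_cst//= probability_setT mule1.
  rewrite -ge0_integralD//; last first.
  + by move=> w _; rewrite lee_fin.
  apply: ge0_le_integral => //.
  + by move=> w _; rewrite lee_fin.
  + by apply: emeasurable_funD => //; exact: measurable_excess.
  + move=> w _; rewrite -EFinD lee_fin ge_max addr_ge0 ?subr_ge0// andbT.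
    by rewrite -lerBlDr le_max; apply/orP; left; lra.
- rewrite -lee_fin -hE.
  rewrite -[delta%:E]mule1 -[X in _ * X](@probability_setT _ _ _ P) -integral_cst//.
  apply: ge0_le_integral => //.
  + by move=> w _; rewrite lee_fin ltW.
  + move=> w _; rewrite lee_fin le_max opprK lerDr sub_reward_ge0//.
- rewrite -lte_fin -hE /mean_excess integral0_eq ?lte_fin// => w _.
  by rewrite max_r// subr_le0 sub_reward_le.
Qed.

(** x <= theta(f) is equivalent to delta <= E(Y - x)^+, and this mean is measurable in f by
    Fubini-Tonelli. *)
Lemma measurable_sub_threshold : measurable_fun setT sub_threshold.
Proof.
move=> mT; apply: (measurability _ (RGenCInfty.measurableE R)) => //.
move=> _ [_ [x ->] <-].
rewrite setTI.
have mex : measurable_fun setT (fun f => mean_excess f x).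
  apply: (@measurable_fun_fubini_tonelli_F _ _ _ _ _ P
    (fun y : L.-tuple R[i] * Omega => (Num.max (Y y.1 1%N y.2 - x) 0)%:E)).
    apply/measurable_EFinP; apply: measurable_maxr => //; apply: measurable_funB => //.
    exact: measurable_sub_reward_joint.
  by move=> y; rewrite lee_fin.
rewrite (_ : _ @^-1` _ = (fun f => mean_excess f x) @^-1` `[delta%:E, +oo[).
  by rewrite -[X in measurable X]setTI; apply: mex => //; exact: emeasurable_itv.
apply/seteqP; split => f /=; rewrite !in_itv/= !andbT hE lee_fin;
  by rewrite (threshold_root f).2.
Qed.

Let past_excess_threshold f n B : past n B ->
  \int[P]_(w in B) (Num.max (Y f n.+1 w - sub_threshold f) 0)%:E =
  delta%:E * P B.
Proof. by move=> nB; rewrite past_excess// (threshold_root f).1. Qed.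

(** M^* with an explicit threshold. It is needed to compute W^*, and only then can
    [sub_threshold_ruleE] identify the two rules. *)
Let M0 (f : L.-tuple R[i]) : Omega -> option nat :=
  first_time (fun m w => (sub_threshold f <= Y f m w)%R).

Let measurable_level f c i : measurable [set z | (c <= reward_at f i z)%R].
Proof.
rewrite (_ : [set z | _] = reward_at f i @^-1` `[c, +oo[).
  rewrite -[X in measurable X]setTI.
  by apply: (measurableT_comp (measurable_reward_at i) (pair1_measurable f)).
by apply/seteqP; split => x /=; rewrite in_itv/= andbT.
Qed.

Let observed_past n D : measurable D ->
  past n.+1 ((fun w => g n.+1 (s n.+1 w) w) @^-1` D).
Proof.
move=> mD; have := @sigma_selected_gains _ _ _ _ _ _ s X g _ e n
  ((fun t => tnth t ord0) @^-1` D).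
rewrite (_ : _ @^-1` (_ @^-1` D) = (fun w => g n.+1 (s n.+1 w) w) @^-1` D); last first.
  by apply/seteqP; split => w; rewrite /= tnth_mktuple.
by apply; rewrite -[X in measurable X]setTI; exact: measurable_tnth.
Qed.

(** An admissible rule uses observed data only, so membership in [past] would not suffice. The split
    along the index is due to the acceptance region of the gain, which varies with it. *)
Let sub_filtration_level f c n :
  sub_filtration s X g n.+1 [set w | (c <= Y f n.+1 w)%R].
Proof.
rewrite (_ : [set w | _] = \big[setU/set0]_(i <- index_enum 'I_L)
    (s n.+1 @^-1` [set i] `&` (fun w => g n.+1 (s n.+1 w) w) @^-1`
       [set z | (c <= reward_at f i z)%R])).
  apply: (@bigsetU_measurable _ (g_sigma_algebraType _)) => i _.
  apply: (@measurableI _ (g_sigma_algebraType _)).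
    exact: filtration_index.
  exact: filtration_observed.
rewrite -bigcup_seq; apply/seteqP; split => w /=.
  by move=> Dw; exists (s n.+1 w); [rewrite /= mem_index_enum|split].
by move=> [i _ [/= <-]].
Qed.

Let sF n : sigma_algebra setT (past n).
Proof. exact: layer_past_sigma. Qed.

Let leF n : past n `<=` past n.+1.
Proof. exact: layer_past_le. Qed.

Let past_level f c n : past n.+1 [set w | (c <= Y f n.+1 w)%R].
Proof.
by apply: (filtration_layer_past observed_past); exact: sub_filtration_level.
Qed.

Let M0_past f : stopping_time P past (M0 f) /\ mean_stop P (M0 f) < +oo.
Proof.
pose A i : set (1.-tuple R[i]) :=
  [set t | (sub_threshold f <= reward_at f i (tnth t ord0))%R].
have mA i : measurable (A i).
  rewrite -[X in measurable X]setTI.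
  exact: (measurable_tnth ord0 measurableT (measurable_level f (sub_threshold f) i)).
have AE n : [set w | (sub_threshold f <= Y f n w)%R] =
    [set w | A (s n w) (selected_gains s g e n w)].
  by apply/seteqP; split => w; rewrite /A /= tnth_mktuple.
pose q := fine (P [set w | (sub_threshold f <= Y f 1%N w)%R]).
have mlev : measurable [set w | (sub_threshold f <= Y f 1%N w)%R].
  by apply: (@mF 1%N); exact: past_level.
have qE : P [set w | (sub_threshold f <= Y f 1%N w)%R] = q%:E.
  by rewrite fineK// fin_num_measure.
have q0 : (0 < q)%R.
  rewrite -lte_fin -qE (_ : [set w | _] =
    [set w | (0 <= Y f 1%N w - sub_threshold f)%R]); last first.
    by apply/seteqP; split => w /=; rewrite subr_ge0.
  apply: (excess_event_gt0 _ delta0).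
    by apply: measurable_funB => //; exact: measurable_sub_reward.
  by rewrite -/(mean_excess f (sub_threshold f)) hE (threshold_root f).1.
have PQ n B : past n B ->
    P (B `&` [set w | (sub_threshold f <= Y f n.+1 w)%R]) = q%:E * P B.
  by move=> nB; rewrite AE (selected_event_shift hm ie 0 mA nB) -AE qE.
have [stM aM] := first_time_geometric sF mF leF
  (Q := fun m w => (sub_threshold f <= Y f m w)%R) q0 (past_level f _) PQ.
by split => //; rewrite aM ltry.
Qed.

Let M0_stopping f : stopping_time P (sub_filtration s X g) (M0 f).
Proof.
have [[M0n _ PN] _] := M0_past f; split => // n.
apply: (F_first_time (@filtration_sigma _ _ _ _ _ _ _ _ _ _)
  (@filtration_le _ _ _ _ _ _ _ _ _ _)) => m.
exact: sub_filtration_level.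
Qed.

Let mean_timeE (M : L.-tuple R[i] -> Omega -> option nat) f : stopping_time P past (M f) ->
  mean_time T tau X M f = (T / 2)%:E + (tau / (2 * p))%:E * mean_stop P (M f).
Proof. by move=> stM; rewrite /mean_time unlock; exact: (integral_slot_time hm). Qed.

Let M0_rule : sub_rule T tau s X g M0.
Proof.
split=> [||f]; first exact: M0_stopping.
- move=> m.
  (* Joint measurability is adaptedness of a first time to the constant family of all measurable
     sets of the product. *)
  apply: (@F_first_time _ (L.-tuple R[i] * Omega)%type (fun _ => measurable) _ _
    (fun m x => (sub_threshold x.1 <= Y x.1 m x.2)%R)) => [n|n A|n] //.
    exact: sigma_algebra_measurable.
  rewrite (_ : [set x | _] = (fun x : L.-tuple R[i] * Omega =>
      (Y x.1 n.+1 x.2 - sub_threshold x.1)%R) @^-1` `[0%R, +oo[); last first.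
    by apply/seteqP; split => x /=; rewrite in_itv/= andbT subr_ge0.
  rewrite -[X in measurable X]setTI; apply: measurable_funB => //.
    exact: measurable_sub_reward_joint.
  exact: (measurableT_comp measurable_sub_threshold).
- have [stM aM] := M0_past f; rewrite mean_timeE// lte_add_pinfty ?ltry//.
  by rewrite lte_mul_pinfty// lee_fin divr_ge0 ?mulr_ge0 ?ltW.
Qed.

Let rule_past M f : sub_rule T tau s X g M -> stopping_time P past (M f).
Proof. by move=> rM; exact: stopping_time_past observed_past (sub_rule_stopping rM f). Qed.

Lemma measurable_mean_reward M : sub_rule T tau s X g M ->
  measurable_fun setT (mean_reward T Ps Pr s g M).
Proof.
move=> rM; rewrite /mean_reward unlock.
apply: (@measurable_fun_fubini_tonelli_F _ _ _ _ _ P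
  (fun x : L.-tuple R[i] * Omega => (stopped (Y x.1) (M x.1) x.2)%:E)).
  rewrite (_ : (fun x => _) = stopped (fun n (x : L.-tuple R[i] * Omega) =>
      (Y x.1 n x.2)%:E : \bar R) (fun x => M x.1 x.2)); last first.
    by apply/funext => x; rewrite /stopped; case: (M x.1 x.2).
  apply: measurable_stopped; first exact: sub_rule_measurable rM.
    by move=> x; have [] := sub_rule_stopping rM x.1.
  by move=> n; apply/measurable_EFinP; exact: measurable_sub_reward_joint.
move=> x; rewrite lee_fin /stopped; case: (M x.1 x.2) => // n.
exact: sub_reward_ge0.
Qed.

Lemma measurable_mean_time M : sub_rule T tau s X g M ->
  measurable_fun setT (mean_time T tau X M).
Proof.
move=> rM; rewrite /mean_time unlock.
apply: (@measurable_fun_fubini_tonelli_F _ _ _ _ _ P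
  (fun x : L.-tuple R[i] * Omega => (stopped (slot_time X T tau) (M x.1) x.2)%:E)).
  rewrite (_ : (fun x => _) = stopped (fun n (x : L.-tuple R[i] * Omega) =>
      (slot_time X T tau n x.2)%:E : \bar R) (fun x => M x.1 x.2)); last first.
    by apply/funext => x; rewrite /stopped; case: (M x.1 x.2).
  apply: measurable_stopped; first exact: sub_rule_measurable rM.
    by move=> x; have [] := sub_rule_stopping rM x.1.
  move=> n; apply/measurable_EFinP; apply: measurableT_comp => //.
  exact: measurable_slot_time.
move=> x; rewrite lee_fin /stopped; case: (M x.1 x.2) => // n.
exact: slot_time_ge0.
Qed.

Lemma mean_reward_ge0 M f : 0 <= mean_reward T Ps Pr s g M f.
Proof.
rewrite /mean_reward unlock integral_ge0// => w _.
by rewrite lee_fin /stopped; case: (M f w) => // n; exact: sub_reward_ge0.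
Qed.

Lemma mean_time_ge0 (M : L.-tuple R[i] -> Omega -> option nat) f : 0 <= mean_time T tau X M f.
Proof.
rewrite /mean_time unlock integral_ge0// => w _.
by rewrite lee_fin /stopped; case: (M f w) => // n; exact: slot_time_ge0.
Qed.

Let measurable_stopped_reward (M : L.-tuple R[i] -> Omega -> option nat) f : stopping_time P past (M f) ->
  measurable_fun setT (fun w => (stopped (Y f) (M f) w)%:E : \bar R).
Proof.
move=> stM; rewrite (_ : (fun w => _) = stopped (fun n w => (Y f n w)%:E) (M f)).
  apply: (measurable_stopping mF stM) => n; apply/measurable_EFinP.
  exact: measurable_sub_reward.
by apply/funext => w; rewrite /stopped; case: (M f w).
Qed.

Let measurable_stopped_time (M : L.-tuple R[i] -> Omega -> option nat) f : stopping_time P past (M f) ->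
  measurable_fun setT (fun w => (stopped (slot_time X T tau) (M f) w)%:E : \bar R).
Proof.
move=> stM.
rewrite (_ : (fun w => _) = stopped (fun n w => (slot_time X T tau n w)%:E) (M f)).
  apply: (measurable_stopping mF stM) => n; apply/measurable_EFinP.
  exact: measurable_slot_time.
by apply/funext => w; rewrite /stopped; case: (M f w).
Qed.

Lemma mean_reward_le_bound M f : sub_rule T tau s X g M ->
  mean_reward T Ps Pr s g M f <= (reward_bound f)%:E.
Proof.
move=> rM; rewrite /mean_reward unlock.
rewrite -[leRHS]mule1 -[X in _ * X](@probability_setT _ _ _ P) -integral_cst//.
apply: ge0_le_integral => //.
- move=> w _; rewrite lee_fin /stopped; case: (M f w) => // n.
  exact: sub_reward_ge0.
- exact/measurable_stopped_reward/rule_past.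
- move=> w _; rewrite lee_fin /stopped; case: (M f w) => [n|].
    exact: sub_reward_le.
  exact: reward_bound_ge0.
Qed.

(** Each observation costs tau / (2 p) > 0 on average, so a finite mean time forces a finite mean
    number of observations. *)
Let mean_stop_fin M f : sub_rule T tau s X g M ->
  exists2 a, (0 <= a)%R & mean_stop P (M f) = a%:E.
Proof.
move=> rM; have stM := rule_past f rM.
have := sub_rule_finite rM f; rewrite mean_timeE//.
have := mean_stop_ge0 P (M f); case: (mean_stop P (M f)) => // [a a0 _|_].
  by exists a.
by rewrite gt0_muley ?lte_fin ?divr_gt0 ?mulr_gt0// addey.
Qed.

Lemma mean_reward_le M f : sub_rule T tau s X g M ->
  mean_reward T Ps Pr s g M f <=
  (sub_threshold f - T / 2 * gamma)%:E + gamma%:E * mean_time T tau X M f.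
Proof.
move=> rM; have stM := rule_past f rM; rewrite mean_timeE//.
have [a a0 aE] := mean_stop_fin f rM.
have := integral_stopped_le sF mF leF (measurable_sub_reward f)
  (sub_reward_ge0 f) (ltW delta0) (@past_excess_threshold f) stM.
rewrite /mean_reward unlock => /le_trans; apply.
rewrite aE -!(EFinM, EFinD) lee_fin /delta.
by rewrite le_eqVlt; apply/orP; left; apply/eqP; field; rewrite gt_eqF.
Qed.

Let mean_reward_M0 f : mean_reward T Ps Pr s g M0 f =
  (sub_threshold f - T / 2 * gamma)%:E + gamma%:E * mean_time T tau X M0 f.
Proof.
have stM := rule_past f M0_rule; rewrite mean_timeE//.
have [a a0 aE] := mean_stop_fin f M0_rule.
rewrite /mean_reward unlock.
rewrite (integral_stopped_eq sF mF leF (measurable_sub_reward f)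
  (sub_reward_ge0 f) (ltW delta0) (@past_excess_threshold f) stM).
  rewrite aE -!(EFinM, EFinD) /delta; congr (_%:E).
  by field; rewrite gt_eqF.
move=> n w /first_timeP[_ tY Yt]; split => // j /Yt.
by rewrite -ltNge.
Qed.

(** Splitting the expectation requires both parts to be integrable: the reward is bounded by
    [reward_bound f], and the time has finite mean by [sub_rule_finite]. *)
Let net_rewardE M f : sub_rule T tau s X g M ->
  'E_P[fun w => (stopped (Y f) (M f) w
                 - gamma * stopped (slot_time X T tau) (M f) w)%R] =
  mean_reward T Ps Pr s g M f - gamma%:E * mean_time T tau X M f.
Proof.
move=> rM; have stM := rule_past f rM.
have mt0 w : 0 <= (stopped (slot_time X T tau) (M f) w)%:E.
  by rewrite lee_fin /stopped; case: (M f w) => // n; exact: slot_time_ge0.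
have mr0 w : 0 <= (stopped (Y f) (M f) w)%:E.
  by rewrite lee_fin /stopped; case: (M f w) => // n; exact: sub_reward_ge0.
have g0 : 0 <= gamma%:E by rewrite lee_fin ltW.
have gE : gamma%:E * mean_time T tau X M f = \int[P]_w
    (gamma%:E * (stopped (slot_time X T tau) (M f) w)%:E).
  by rewrite ge0_integralZl// ?/mean_time ?unlock//; exact: measurable_stopped_time.
rewrite gE /mean_reward unlock -integralB//.
- apply/integrableP; split; first exact: measurable_stopped_reward.
  under eq_integral do rewrite gee0_abs//.
  have := mean_reward_le_bound f rM; rewrite /mean_reward unlock => /le_lt_trans.
  by apply; exact: ltry.
- apply/integrableP; split.
    by apply: measurable_funeM; exact: measurable_stopped_time.
  under eq_integral do rewrite gee0_abs ?mule_ge0//.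
  by rewrite -gE lte_mul_pinfty//; exact: (sub_rule_finite rM f).
Qed.

Lemma sub_valueE f : sub_value T tau Ps Pr s X g gamma f =
  (sub_threshold f - T / 2 * gamma)%:E.
Proof.
have tfin M : sub_rule T tau s X g M ->
    gamma%:E * mean_time T tau X M f \is a fin_num.
  move=> rM; rewrite fin_numM// ge0_fin_numE; first exact: (sub_rule_finite rM f).
  exact: mean_time_ge0.
apply/eqP; rewrite eq_le; apply/andP; split.
  apply: ge_ereal_sup => _ [M rM <-]; rewrite net_rewardE//.
  by rewrite leeBlDr ?tfin// mean_reward_le.
apply: ereal_sup_ubound; exists M0; first exact: M0_rule.
by rewrite net_rewardE ?mean_reward_M0 ?addeK ?tfin//; exact: M0_rule.
Qed.

Let sub_threshold_ruleE : sub_threshold_rule T tau Ps Pr s X g gamma = M0.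
Proof.
apply/funext => f; congr first_time; apply/funext => m; apply/funext => w.
by rewrite sub_valueE -EFinD subrK lee_fin.
Qed.

Lemma sub_threshold_rule_is_rule :
  sub_rule T tau s X g (sub_threshold_rule T tau Ps Pr s X g gamma).
Proof. by rewrite sub_threshold_ruleE; exact: M0_rule. Qed.

Lemma mean_reward_sub_threshold_rule f :
  let M := sub_threshold_rule T tau Ps Pr s X g gamma in
  mean_reward T Ps Pr s g M f =
  (sub_threshold f - T / 2 * gamma)%:E + gamma%:E * mean_time T tau X M f.
Proof. by rewrite /= sub_threshold_ruleE; exact: mean_reward_M0. Qed.

End sub_layer.

(** * The main-layer problem *)

Section stopped_sums.
Local Open Scope ereal_scope.
Context d (Omega : measurableType d) (R : realType) (P : probability Omega R).
Context (F : nat -> set_system Omega) (mF : forall n, F n `<=` measurable).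
Context (N : Omega -> option nat) (stN : stopping_time P F N).

Lemma integral_stoppedD (A B : nat -> Omega -> \bar R) :
  (forall n, measurable_fun setT (A n.+1)) -> (forall n w, 0 <= A n w) ->
  (forall n, measurable_fun setT (B n.+1)) -> (forall n w, 0 <= B n w) ->
  \int[P]_w stopped (fun n w => A n w + B n w) N w =
  \int[P]_w stopped A N w + \int[P]_w stopped B N w.
Proof.
move=> mA A0 mB B0; rewrite -ge0_integralD//.
- by apply: eq_integral => w _; rewrite /stopped; case: (N w) => //; rewrite adde0.
- by move=> w _; rewrite /stopped; case: (N w).
- exact: (measurable_stopping mF stN).
- by move=> w _; rewrite /stopped; case: (N w).
- exact: (measurable_stopping mF stN).
Qed.

Lemma le_integral_stopped (A B : nat -> Omega -> \bar R) :
  (forall n, measurable_fun setT (A n.+1)) -> (forall n w, 0 <= A n w) ->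
  (forall n, measurable_fun setT (B n.+1)) ->
  (forall n w, N w = Some n.+1 -> A n.+1 w <= B n.+1 w) ->
  \int[P]_w stopped A N w <= \int[P]_w stopped B N w.
Proof.
move=> mA A0 mB AB; apply: ge0_le_integral => //.
- by move=> w _; rewrite /stopped; case: (N w).
- exact: (measurable_stopping mF stN).
- exact: (measurable_stopping mF stN).
- move=> w _; rewrite /stopped; case E : (N w) => [[|n]|]//.
    by have [/(_ w)] := stN; rewrite E.
  exact: AB.
Qed.

Lemma eq_integral_stopped (A B : nat -> Omega -> \bar R) :
  (forall n w, N w = Some n.+1 -> A n.+1 w = B n.+1 w) ->
  \int[P]_w stopped A N w = \int[P]_w stopped B N w.
Proof.
move=> AB; apply: eq_integral => w _; rewrite /stopped.
case E : (N w) => [[|n]|]//; last exact: AB.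
by have [/(_ w)] := stN; rewrite E.
Qed.

End stopped_sums.

Section main_layer.
Local Open Scope ereal_scope.
Context d (Omega : measurableType d) (R : realType) (P : probability Omega R).
Context (K L : nat) (T tau : R) (s : nat -> Omega -> 'I_K).
Context (X : nat -> {RV P >-> nat}) (f : nat -> 'I_K * 'I_L -> {RV P >-> R[i]}).
Context (p v gamma : R) (hm : layer_model s X f p v).
Hypotheses (p0 : (0 < p)%R) (v0 : (0 < v)%R) (T0 : (0 < T)%R) (tau0 : (0 < tau)%R)
  (gamma0 : (0 < gamma)%R).

Local Notation past := (layer_past s X f).
Local Notation sg := (source_gains s f).
Let delta : R := (tau * gamma / (2 * p))%R.
Let level : R := (T / 2 * gamma)%R.

Let delta0 : (0 < delta)%R. Proof. by rewrite divr_gt0 ?mulr_gt0. Qed.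
Let level0 : (0 < level)%R. Proof. by rewrite mulr_gt0 ?divr_gt0. Qed.

Let e (i : 'I_K) (j : 'I_L) : 'I_K * 'I_L := (i, j).
Let ie i : injective (e i). Proof. by move=> x y []. Qed.

Let sF n : sigma_algebra setT (past n). Proof. exact: layer_past_sigma. Qed.
Let leF n : past n `<=` past n.+1. Proof. exact: layer_past_le. Qed.
Let mF := layer_past_measurable hm.

Let observed_past n D : measurable D -> past n.+1 (sg n.+1 @^-1` D).
Proof. exact: sigma_selected_gains. Qed.

Lemma measurable_source_gains n : measurable_fun setT (sg n.+1).
Proof. exact: (measurable_selected_gains hm). Qed.

Lemma main_rule_past N : main_rule s X f N -> stopping_time P past N.
Proof. exact: stopping_time_past observed_past. Qed.

Lemma source_gains_shift (phi : L.-tuple R[i] -> \bar R) n l B :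
  measurable_fun setT phi -> (forall t, 0 <= phi t) -> past n B ->
  \int[P]_(w in B) phi (sg n.+1 w) = (\int[P]_w phi (sg l.+1 w)) * P B.
Proof.
move=> mphi phi0; exact: (integral_selected_shift hm ie (phi := fun=> phi)).
Qed.

Context (W : L.-tuple R[i] -> R) (mW : measurable_fun setT W).
Context (n0 : nat) (hroot : \int[P]_w (Num.max (W (sg n0.+1 w) - level) 0)%:E = delta%:E).

Let surplus n w : R := (W (sg n w) - level)%R.
Let excess n w : \bar R := (Num.max (surplus n w) 0)%:E.

Let msurplus n : measurable_fun setT (surplus n.+1).
Proof.
apply: measurable_funB => //; apply: measurableT_comp => //.
exact: measurable_source_gains.
Qed.

Let mexcess n : measurable_fun setT (excess n.+1).
Proof. by apply/measurable_EFinP; exact: measurable_maxr. Qed.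

Let excess0 n w : 0 <= excess n w.
Proof. by rewrite lee_fin le_max lexx orbT. Qed.

Let past_excess n B : past n B ->
  \int[P]_(w in B) excess n.+1 w = delta%:E * P B.
Proof.
(* The equation is given at the single time [n0.+1]; stationarity and independence carry it to every
   time and every past event. *)
move=> nB; rewrite -hroot.
apply: (@source_gains_shift (fun t => (Num.max (W t - level) 0)%:E)) => //.
- by apply/measurable_EFinP; apply: measurable_maxr => //; exact: measurable_funB.
- by move=> t; rewrite lee_fin le_max lexx orbT.
Qed.

Definition main_threshold_rule : Omega -> option nat :=
  first_time (fun n w => (level <= W (sg n w))%R).

Let filtration_level n :
  filtration s X sg n.+1 [set w | (level <= W (sg n.+1 w))%R].
Proof.
apply: (@filtration_observed _ _ _ _ _ _ _ _ _ _ _ [set t | (level <= W t)%R]) => //.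
rewrite (_ : [set t | _] = W @^-1` `[level, +oo[).
  by rewrite -[X in measurable X]setTI; exact: mW.
by apply/seteqP; split => x /=; rewrite in_itv/= andbT.
Qed.

Let past_level n : past n.+1 [set w | (level <= W (sg n.+1 w))%R].
Proof.
by apply: (filtration_layer_past observed_past); exact: filtration_level.
Qed.

Let threshold_past : stopping_time P past main_threshold_rule /\
  mean_stop P main_threshold_rule < +oo.
Proof.
have mlev : measurable [set w | (level <= W (sg n0.+1 w))%R].
  by apply: (@mF n0.+1); exact: past_level.
pose q := fine (P [set w | (level <= W (sg n0.+1 w))%R]).
have qE : P [set w | (level <= W (sg n0.+1 w))%R] = q%:E.
  by rewrite fineK// fin_num_measure.
have q0 : (0 < q)%R.
  rewrite -lte_fin -qE (_ : [set w | _] = [set w | (0 <= surplus n0.+1 w)%R]); last first.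
    by apply/seteqP; split => w /=; rewrite subr_ge0.
  exact: (excess_event_gt0 _ delta0).
have PQ n B : past n B ->
    P (B `&` [set w | (level <= W (sg n.+1 w))%R]) = q%:E * P B.
  move=> nB; rewrite -qE.
  apply: (selected_event_shift hm ie n0 (A := fun=> [set t | (level <= W t)%R])) => // _.
  rewrite (_ : [set t | _] = W @^-1` `[level, +oo[).
    by rewrite -[X in measurable X]setTI; exact: mW.
  by apply/seteqP; split => x /=; rewrite in_itv/= andbT.
have [stN aN] := first_time_geometric sF mF leF
  (Q := fun m w => (level <= W (sg m w))%R) q0 past_level PQ.
by split => //; rewrite aN ltry.
Qed.

Lemma main_threshold_rule_is_rule : main_rule s X f main_threshold_rule.
Proof.
have [[Nn _ PN] _] := threshold_past; split => // n.
apply: (F_first_time (@filtration_sigma _ _ _ _ _ _ _ _ _ _)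
  (@filtration_le _ _ _ _ _ _ _ _ _ _)) => m.
exact: filtration_level.
Qed.

Section pair.
Context (Ybar Tbar : L.-tuple R[i] -> \bar R).
Hypotheses (mY : measurable_fun setT Ybar) (Y0 : forall t, 0 <= Ybar t)
  (mT : measurable_fun setT Tbar) (Tb0 : forall t, 0 <= Tbar t)
  (YT : forall t, Ybar t <= (W t)%:E + gamma%:E * Tbar t).

Let mYsg n : measurable_fun setT (fun w => Ybar (sg n.+1 w)).
Proof. by apply: measurableT_comp => //; exact: measurable_source_gains. Qed.

Let mTsg n : measurable_fun setT (fun w => Tbar (sg n.+1 w)).
Proof. by apply: measurableT_comp => //; exact: measurable_source_gains. Qed.

Let msum n : measurable_fun setT (fun w => \sum_(1 <= i < n.+2) excess i w).
Proof.
under eq_fun do rewrite big_add1/= big_mkord.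
by apply: emeasurable_sum => i.
Qed.

Let mbound n : measurable_fun setT (fun w => gamma%:E * Tbar (sg n.+1 w) +
  (level%:E + \sum_(1 <= i < n.+2) excess i w)).
Proof.
apply: emeasurable_funD; first exact: measurable_funeM.
exact: emeasurable_funD.
Qed.

Lemma total_timeE N : stopping_time P past N ->
  total_time T tau s X f Tbar N =
  \int[P]_w stopped (fun n w => Tbar (sg n w)) N w +
  ((T / 2)%:E + (tau / (2 * p))%:E * mean_stop P N).
Proof.
move=> stN; rewrite /total_time -(integral_slot_time hm)//.
rewrite (integral_stoppedD mF stN)//.
- congr (_ + _); apply: eq_integral => w _.
  by rewrite /stopped; case: (N w).
- by move=> n; apply/measurable_EFinP; exact: measurable_slot_time.
- by move=> n w; rewrite lee_fin slot_time_ge0.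
Qed.

(** Since level = gamma T / 2 and delta = gamma tau / (2 p), the constant and the Wald sum account
    for gamma times the fixed part and the contention part of E T_N. *)
Let time_bound N : stopping_time P past N ->
  \int[P]_w stopped (fun n w => gamma%:E * Tbar (sg n w) +
    (level%:E + \sum_(1 <= i < n.+1) excess i w)) N w =
  gamma%:E * total_time T tau s X f Tbar N.
Proof.
move=> stN; rewrite total_timeE//.
have g0 : 0 <= gamma%:E by rewrite lee_fin ltW.
have a0 := mean_stop_ge0 P N.
rewrite (integral_stoppedD mF stN); first last.
- by move=> n w; rewrite adde_ge0 ?sume_ge0// lee_fin ltW.
- by move=> n; apply: emeasurable_funD.
- by move=> n w; rewrite mule_ge0.
- by move=> n; apply: measurable_funeM.
rewrite (integral_stoppedD mF stN); first last.
- by move=> n w; rewrite sume_ge0.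
- exact: msum.
- by move=> n w; rewrite lee_fin ltW.
- by move=> n; exact: measurable_cst.
rewrite (integral_stopped_cst mF stN); last by rewrite lee_fin ltW.
rewrite (integral_stopped_sum sF mF leF stN mexcess excess0 (ltW delta0) past_excess).
rewrite ge0_muleDr; first last.
- by rewrite adde_ge0 ?mule_ge0 ?lee_fin ?divr_ge0 ?mulr_ge0 ?(ltW T0) ?(ltW tau0) ?(ltW p0).
- by apply: integral_ge0 => w _; rewrite /stopped; case: (N w).
congr (_ + _).
  rewrite -ge0_integralZl//; first last.
  - by move=> w _; rewrite /stopped; case: (N w).
  - exact: (measurable_stopping mF stN).
  by apply: eq_integral => w _; rewrite /stopped; case: (N w) => //; rewrite mule0.
rewrite ge0_muleDr ?mule_ge0 ?lee_fin ?divr_ge0 ?mulr_ge0 ?(ltW T0) ?(ltW tau0) ?(ltW p0)//.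
rewrite muleA -!EFinM /level /delta; congr (_%:E + _%:E * _); first by rewrite mulrC.
by rewrite mulrA [(gamma * _)%R]mulrC.
Qed.

(** The sub-layer enters only through [YT]: at the stopping index, Ybar <= gamma Tbar + level + (W -
    level)^+. *)
Lemma total_reward_le N : stopping_time P past N ->
  total_reward s f Ybar N <= gamma%:E * total_time T tau s X f Tbar N.
Proof.
move=> stN; rewrite -time_bound//; apply: (le_integral_stopped mF stN) => //.
move=> n w _; apply: le_trans (YT _) _; rewrite addeC; apply: leeD => //.
rewrite big_nat_recr//=; apply: (@le_trans _ _ (level%:E + excess n.+1 w)).
  by rewrite -EFinD lee_fin -lerBlDl le_max lexx.
by rewrite leeD2lE// leeDr// sume_ge0.
Qed.

(** The fixed part T / 2 is always spent; this makes the throughput a genuine quotient. *)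
Lemma total_time_gt0 N : stopping_time P past N ->
  0 < total_time T tau s X f Tbar N.
Proof.
move=> stN; rewrite total_timeE//.
apply: (@lt_le_trans _ _ (T / 2)%:E); first by rewrite lte_fin divr_gt0.
have a0 := mean_stop_ge0 P N.
rewrite addeCA leeDl// adde_ge0//.
  by apply: integral_ge0 => w _; rewrite /stopped; case: (N w).
by rewrite mule_ge0// lee_fin divr_ge0 ?mulr_ge0 ?(ltW tau0) ?(ltW p0).
Qed.

Hypothesis YTE : forall t, Ybar t = (W t)%:E + gamma%:E * Tbar t.

Lemma total_reward_main_threshold_rule :
  total_reward s f Ybar main_threshold_rule =
  gamma%:E * total_time T tau s X f Tbar main_threshold_rule.
Proof.
have [stN _] := threshold_past; rewrite -time_bound//.
apply: (eq_integral_stopped stN) => n w /first_timeP[_ lW Wl].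
rewrite YTE addeC; congr (_ + _).
rewrite big_nat_recr//= big_nat big1 ?add0e.
  by rewrite /excess /surplus max_l ?subr_ge0// -EFinD addrC subrK.
move=> j jn; rewrite /excess /surplus max_r//.
by rewrite subr_le0 ltW// ltNge Wl.
Qed.

(** Stopping occurs where W >= level > 0, and there [YTE] gives gamma Tbar <= Ybar <= C. *)
Lemma total_time_main_threshold_rule (C : L.-tuple R[i] -> \bar R) :
  measurable_fun setT C -> (forall t, 0 <= C t) -> (forall t, Ybar t <= C t) ->
  \int[P]_w C (sg 1%N w) < +oo ->
  total_time T tau s X f Tbar main_threshold_rule < +oo.
Proof.
move=> mC C0 YC C1; have [stN aN] := threshold_past.
rewrite total_timeE//; apply: lte_add_pinfty; last first.
  rewrite lte_add_pinfty ?ltry// lte_mul_pinfty//.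
  by rewrite lee_fin divr_ge0 ?mulr_ge0 ?(ltW tau0) ?(ltW p0).
(* Bounds the sub-layer time at the stopping index. Its value there is one term of the sum over i <=
   N, whose mean is c E N. *)
pose D n w := (gamma^-1)%:E * C (sg n w).
have g0 : 0 <= (gamma^-1)%:E by rewrite lee_fin invr_ge0 ltW.
have mCsg n : measurable_fun setT (fun w => C (sg n.+1 w)).
  by apply: measurableT_comp => //; exact: measurable_source_gains.
have mD n : measurable_fun setT (D n.+1) by exact: measurable_funeM.
have D0 n w : 0 <= D n w by rewrite mule_ge0.
pose c := fine (\int[P]_w D 1%N w).
have Dfin : \int[P]_w D 1%N w \is a fin_num.
  rewrite ge0_fin_numE ?integral_ge0// ge0_integralZl//.
  exact: lte_mul_pinfty.
have cE : \int[P]_w D 1%N w = c%:E by rewrite fineK.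
have c0 : (0 <= c)%R by apply: fine_ge0; exact: integral_ge0.
have DF n B : past n B -> \int[P]_(w in B) D n.+1 w = c%:E * P B.
  move=> nB; rewrite -cE.
  apply: (@source_gains_shift (fun t => (gamma^-1)%:E * C t)) => //.
    exact: measurable_funeM.
  by move=> t; rewrite mule_ge0.
apply: (@le_lt_trans _ _ (\int[P]_w
    stopped (fun n w => \sum_(1 <= i < n.+1) D i w) main_threshold_rule w)).
  apply: (le_integral_stopped mF stN) => //.
    move=> n; under eq_fun do rewrite big_add1/= big_mkord.
    by apply: emeasurable_sum => i.
  move=> n w /first_timeP[_ lW _]; rewrite big_nat_recr//=.
  apply: (@le_trans _ _ (D n.+1 w)); last by rewrite leeDr// sume_ge0.
  rewrite /D lee_pdivlMl//; apply: le_trans (YC _); rewrite YTE leeDr//.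
  by rewrite lee_fin (le_trans _ lW)// ltW.
rewrite (integral_stopped_sum sF mF leF stN mD D0 c0 DF).
by rewrite lte_mul_pinfty ?lee_fin.
Qed.

End pair.

(** The selected row is dominated by the sum over all rows, a finite sum of Gaussian second
    moments. *)
Lemma source_gains_moment :
  \int[P]_w (\sum_(j < L) ComplexField.Normc.normc (tnth (sg 1%N w) j) ^+ 2)%:E < +oo.
Proof.
pose Z (x : 'I_K * 'I_L) w : \bar R :=
  (ComplexField.Normc.normc (f 1%N x w) ^+ 2)%:E.
have mZ x : measurable_fun setT (Z x).
  apply/measurable_EFinP; apply: (measurableT_comp (@measurable_normc_sqr R)).
  exact: measurable_funP.
have Z0 x w : 0 <= Z x w by rewrite lee_fin sqr_ge0.
apply: (@le_lt_trans _ _ (\int[P]_w \sum_(i < K) \sum_(j < L) Z (i, j) w)).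
  apply: ge0_le_integral => //.
  - by move=> w _; rewrite lee_fin sumr_ge0// => j _; exact: sqr_ge0.
  - apply/measurable_EFinP; apply: measurable_sum => j.
    apply: (measurableT_comp (@measurable_normc_sqr R)).
    apply: (measurableT_comp (measurable_tnth j)).
    exact: measurable_source_gains.
  - by apply: emeasurable_sum => i; exact: emeasurable_sum.
  - move=> w _; rewrite -sumEFin.
    rewrite (bigD1 (s 1%N w))//=.
    apply: (@le_trans _ _ (\sum_(j < L) Z (s 1%N w, j) w)).
      by apply: lee_sum => j _; rewrite tnth_mktuple.
    by rewrite leeDl// sume_ge0// => i _; exact: sume_ge0.
rewrite ge0_integral_sum//; first last.
- by move=> i w _; exact: sume_ge0.
- by move=> i; exact: emeasurable_sum.
apply: lte_sum_pinfty => i _; rewrite ge0_integral_sum//.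
apply: lte_sum_pinfty => j _.
apply: (circular_gaussian_sqr_moment v0); exact: (layer_gaussian hm).
Qed.

End main_layer.

(** * The two layers combined *)

Lemma success_prob_gt0 (R : realType) k (q : R) :
  (1 <= k)%N -> 0 < q < 1 -> 0 < success_prob k q.
Proof.
move=> k1 /andP[q0 q1].
by rewrite !mulr_gt0 ?ltr0n// exprn_gt0// subr_gt0.
Qed.

Theorem mainTheorem7 (R : realType) (K L : nat)
  (T tau Ps Pr sigmaf2 sigmag2 p0 p1 : R)
  (hK : (1 <= K)%N) (hL : (1 <= L)%N)
  (hT : 0 < T) (htau : 0 < tau) (hPs : 0 < Ps) (hPr : 0 < Pr)
  (hsigmaf2 : 0 < sigmaf2) (hsigmag2 : 0 < sigmag2)
  (hp0 : 0 < p0 < 1) (hp1 : 0 < p1 < 1)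
  (* main layer *)
  (d : measure_display) (Omega : measurableType d) (P : probability Omega R)
  (s : nat -> Omega -> 'I_K) (X : nat -> {RV P >-> nat})
  (f : nat -> 'I_K * 'I_L -> {RV P >-> R[i]})
  (hmain : layer_model s X f (success_prob K p0) sigmaf2)
  (* sub-layer *)
  (d' : measure_display) (Omega' : measurableType d') (P' : probability Omega' R)
  (s' : nat -> Omega' -> 'I_L) (X' : nat -> {RV P' >-> nat})
  (g : nat -> 'I_L -> {RV P' >-> R[i]})
  (hsub : layer_model s' X' g (success_prob L p1) sigmag2)
  (gamma : R) (hgamma : 0 < gamma) (n : nat) (hn : (1 <= n)%N)
  (hroot : (\int[P]_w maxe
      (sub_value T tau Ps Pr s' X' g gamma (source_gains s f n w)
         - (T / 2 * gamma)%:E) 0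
    = (tau * gamma / (2 * success_prob K p0))%:E)%E) :
  let W := sub_value T tau Ps Pr s' X' g gamma in
  let reward N M :=
    total_reward s f (mean_reward T Ps Pr s' g M) N in
  let time N M :=
    total_time T tau s X f (mean_time T tau X' M) N in
  let Nstar := first_time (fun n w =>
    ((T / 2 * gamma)%:E <= W (source_gains s f n w))%E) in
  let Mstar := sub_threshold_rule T tau Ps Pr s' X' g gamma in
  [/\ main_rule s X f Nstar,
      sub_rule T tau s' X' g Mstar,
      (time Nstar Mstar < +oo)%E,
      (gamma%:E = reward Nstar Mstar / time Nstar Mstar)%E &
      gamma%:E = ereal_sup
        [set e | exists N M, [/\ main_rule s X f N,
           sub_rule T tau s' X' g M,
           (time N M < +oo)%E & (e = reward N M / time N M)%E]]].
Proof.
move=> W reward time Nstar Mstar.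
have ps0 := success_prob_gt0 hK hp0.
have pr0 := success_prob_gt0 hL hp1.
have WE t := sub_valueE hsub pr0 hT htau hPs hPr hgamma t.
pose theta := sub_threshold T tau Ps Pr s' g (success_prob L p1) gamma.
(* W^* as a real-valued function, the reward of the main-layer problem. *)
pose V t : R := theta t - T / 2 * gamma.
have mV : measurable_fun setT V.
  apply: measurable_funB => //.
  exact: (measurable_sub_threshold hsub pr0 hT htau hPs hPr hgamma).
have root : (\int[P]_w (Num.max (V (source_gains s f n.-1.+1 w) - T / 2 * gamma) 0)%:E =
    (tau * gamma / (2 * success_prob K p0))%:E)%E.
  rewrite -hroot prednK//; apply: eq_integral => w _.
  by rewrite WE -EFinB EFin_max.
have NE : Nstar = main_threshold_rule T s f gamma V.
  congr first_time; apply/funext => m; apply/funext => w.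
  by rewrite /W WE lee_fin.
have rMstar : sub_rule T tau s' X' g Mstar.
  exact: (sub_threshold_rule_is_rule hsub pr0 hT htau hPs hPr hgamma).
have rNstar : main_rule s X f Nstar.
  by rewrite NE; exact: (main_threshold_rule_is_rule hmain ps0 htau hgamma mV root).
have Tb0 M (t : L.-tuple R[i]) := mean_time_ge0 X' hT htau M t.
have starE t : mean_reward T Ps Pr s' g Mstar t =
    ((V t)%:E + gamma%:E * mean_time T tau X' Mstar t)%E.
  exact: (mean_reward_sub_threshold_rule hsub pr0 hT htau hPs hPr hgamma).
have mTstar := measurable_mean_time hT htau rMstar.
have time_star : (time Nstar Mstar < +oo)%E.
  rewrite /time NE; apply: (total_time_main_threshold_rule hmain ps0 hT htau hgamma
    mV root mTstar (Tb0 Mstar) starE (C := fun t => (reward_bound T Ps t)%:E)).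
  - apply/measurable_EFinP; apply: measurable_funM => //.
    apply: measurable_sum => j; apply: (measurableT_comp (@measurable_normc_sqr R)).
    exact: measurable_tnth.
  - by move=> t; rewrite lee_fin reward_bound_ge0.
  - move=> t; exact: (mean_reward_le_bound hsub hT hPs hPr t rMstar).
  - under eq_integral do rewrite /reward_bound EFinM.
    have c0 : 0 <= T / 2 * (Ps / ln 2).
      by rewrite mulr_ge0 ?divr_ge0 ?(ltW hT) ?(ltW hPs)// ln_ge0// ler1n.
    rewrite ge0_integralZl//.
    + rewrite lte_mul_pinfty//; exact: (source_gains_moment hmain hsigmaf2).
    + apply/measurable_EFinP; apply: measurable_sum => j.
      apply: (measurableT_comp (@measurable_normc_sqr R)).
      apply: (measurableT_comp (measurable_tnth j)).
      exact: (measurable_source_gains hmain).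
    + by move=> w _; rewrite lee_fin sumr_ge0// => j _; exact: sqr_ge0.
have reward_star : (reward Nstar Mstar = gamma%:E * time Nstar Mstar)%E.
  rewrite /reward /time NE; exact: (total_reward_main_threshold_rule
    hmain ps0 hT htau hgamma mV root mTstar (Tb0 Mstar) starE).
(* A positive finite denominator reduces division in [\bar R] to division of reals. *)
have timeE N M : main_rule s X f N -> sub_rule T tau s' X' g M ->
    (time N M < +oo)%E -> exists2 t, 0 < t & time N M = t%:E.
  move=> rN rM; have : (0 < time N M)%E.
    apply: (total_time_gt0 hmain ps0 hT htau (measurable_mean_time hT htau rM)
      (Tb0 M)).
    exact: (main_rule_past rN).
  by case: (time N M) => // t t0 _; exists t.
have ratio_star : (gamma%:E = reward Nstar Mstar / time Nstar Mstar)%E.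
  have [t t0 tE] := timeE _ _ rNstar rMstar time_star.
  by rewrite reward_star tE inver gt_eqF// -!EFinM mulfK// gt_eqF.
split => //; apply/eqP; rewrite eq_le; apply/andP; split.
  by apply: ereal_sup_ubound; exists Nstar, Mstar.
apply: ge_ereal_sup => _ [N [M [rN rM tfin ->]]].
have [t t0 tE] := timeE _ _ rN rM tfin.
rewrite tE inver gt_eqF// lee_pdivrMr// -tE.
apply: (total_reward_le hmain ps0 hT htau hgamma mV root).
- exact: (measurable_mean_reward hsub hT hPs hPr rM).
- by move=> u; exact: mean_reward_ge0.
- exact: (measurable_mean_time hT htau rM).
- exact: Tb0.
- by move=> u; exact: (mean_reward_le hsub pr0 hT htau hPs hPr hgamma u rM).
- exact: (main_rule_past rN).
Qed.
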